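(* Let Assumptions 0, 1, 2, 3 (see context) hold. There exist $\rho_f>0$ and $\rho_u>0$ such that, writing $B_f=\{f\in\mathcal U_\#(\mathcal L):|f|_{-1,\infty}<\rho_f\}$, $B_*=\{u\in\mathcal U_\#(\mathcal L):|u-\epsilon\chi_*^\epsilon|_{1,\infty}<\rho_u\}$ and $B_0=\{u\in\mathcal U_\#(\mathcal L):|u|_{1,\infty}<\rho_u\}$: (a) For all $f\in B_f$ the solution $u$ of the atomistic problem $\langle\delta E(u),v\rangle_{\mathcal L}=\langle f,v\rangle_{\mathcal L}$ $\forall v\in\mathcal U_\#(\mathcal L)$ exists and is unique in $B_*$. Moreover $u=u(f)\in C^{1,1}(B_f;B_* )$, with $\|\delta_fu\|_{C}\le c_0^{-1}$ and $|\delta_fu|_{C^{0,1}}\le\mathrm{Const}(c_0,C_\Phi^{(2)})$. (b) For all $f\in B_f$ the solution $u^0$ of the homogenized problem $\langle\delta\Phi^0(Du^0),Dv\rangle_{\mathcal L}=\langle f,v\rangle_{\mathcal L}$ $\forall v\in\mathcal U_\#(\mathcal L)$ exists and is unique in $B_0$. Moreover $u^0=u^0(f)\in C^{1,1}(B_f;B_0)$, with $\|\delta_fu^0\|_{C}\le c_0^{-1}$, $|\delta_fu^0|_{C^{0,1}}\le\mathrm{Const}(c_0,C_\Phi^{(2)})$, and $$|u^0(f)|_{2,\infty}\le c_0^{-1}\|f\|_\infty\qquad\forall f\in B_f .$$ In addition, the corrected solution $u^{\rm c}:=\mathcal I_\#\big(u^0+\epsilon\chi^\epsilon(Du^0)\big)$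 lies in $B_*$. (c) For all $f\in B_f$ the following estimates hold: $$2\|u^{\rm c}-u\|_\infty\le|u^{\rm c}-u|_{1,\infty}\le\epsilon\,\mathrm{Const}\big(c_0^{-1}C_\Phi^{(1,1)}\big)\,|u^0|_{2,\infty},$$ $$\|u^0-u\|_\infty\le\epsilon\,\mathrm{Const}\big(c_0^{-1}C_\Phi^{(1,1)}\big)\,|u^0|_{2,\infty}+\epsilon\,\mathrm{Const}(p).$$
   Context: Lattices. Fix positive integers $p$, $R$ and a positive multiple $N$ of $p$; $\epsilon=1/N$, $\mathcal L=\{\epsilon,2\epsilon,\dots,N\epsilon\}$, $\mathcal P=\{1,\dots,p\}$. $\mathcal U(\mathcal L)$ is the space of functions $u:\epsilon\mathbb Z\to\mathbb R$ with $u(x+1)=u(x)$ (note $\epsilon N=1$); $\langle u\rangle_{\mathcal L}=\frac1N\sum_{x\in\mathcal L}u(x)$, $\langle u,v\rangle_{\mathcal L}=\langle uv\rangle_{\mathcal L}$, $\mathcal U_\#(\mathcal L)=\{u\in\mathcal U(\mathcal L):\langle u\rangle_{\mathcal L}=0\}$, $\mathcal I_\# u=u-\langle u\rangle_{\mathcal L}$. $D_ru(x)=\frac{u(x+r\epsilon)-u(x)}{r\epsilon}$, $D=D_1$. Likewise $\mathcal U(\mathcal P)$ is the space of $p$-periodic functions $\mathbb Z\to\mathbb R$, $\langle\eta\rangle_{\mathcal P}=\frac1p\sum_{y=1}^p\eta(y)$, $\mathcal U_\#(\mathcal P)$ its zero-mean subspace, $D_{y,r}\eta(y)=\frac{\eta(y+r)-\eta(y)}{r}$,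 $D_y=D_{y,1}$. Norms: $\|u\|_q=\langle|u|^q\rangle^{1/q}$, $\|u\|_\infty=\max|u|$, $|u|_{m,q}=\|D^mu\|_q$ for integers $m\ge0$ (with $D_y$ on $\mathcal P$), $|u|_{-1,\infty}=\sup\{\langle u,v\rangle: v\in\mathcal U_\#,\ |v|_{1,1}=1\}$. $\mathcal U_\#^{m,\infty}(\mathcal L)$ is $\mathcal U_\#(\mathcal L)$ with the norm $|\cdot|_{m,\infty}$. Suprema over empty sets are $0$, infima over empty sets are $+\infty$. Potentials. For $1\le r\le R$ and $y\in\mathbb Z$ ($p$-periodically in $y$) $\Phi_r(\cdot;y)$ is a real function of one real variable on an open interval; $\delta\Phi_r,\delta^2\Phi_r$ are its first and second derivatives in that variable. $\Phi_r^\epsilon(z;x)=\Phi_r(z;x/\epsilon)$. The energy is $E(u)=\big\langle\sum_{r=1}^R\Phi_r^\epsilon(D_ru(x);x)\big\rangle_{x\in\mathcal L}$ and $\langle\delta E(u),v\rangle_{\mathcal L}=\frac{d}{dt}E(u+tv)|_{t=0}$. Assumptions. There are $\chi_*\in\mathcal U_\#(\mathcal P)$ and $\rho_\Phi>0$ with: (0) $y\mapsto y+\chi_*(y)$ is strictly increasing on $\mathbb Z$. (1) For all $r,y$, $\Phi_r(\cdot;y)$ is defined on the interval of radius $\rho_\Phi$ about $D_{y,r}\chi_*(y)$ and is $C^{2,1}$ there (second derivative Lipschitz). (2) $\sum_{r=1}^R\langle\delta\Phi_r(D_{y,r}\chi_*(y);y),D_{y,r}\eta(y)\rangle_{y\in\mathcal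 P}=0$ for all $\eta\in\mathcal U_\#(\mathcal P)$. (3) $\frac12\min_y\delta^2\Phi_1(D_{y,1}\chi_*(y);y)-\sum_{r=2}^R\max_y|\delta^2\Phi_r(D_{y,r}\chi_*(y);y)|>0$. Homogenization. $\rho_z,\rho_\chi>0$ are fixed, sufficiently small (with $\rho_\chi$ bounded by an absolute constant), so that for $|z|<\rho_z$ there is a unique $\chi(z)=\chi(z;\cdot)\in\mathcal U_\#(\mathcal P)$ with $|\chi(z)-\chi_*|_{1,\infty}<\rho_\chi$ and $\sum_{r=1}^R\langle\delta\Phi_r(z+D_{y,r}\chi(z;y);y),D_{y,r}\eta(y)\rangle_{y\in\mathcal P}=0$ for all $\eta\in\mathcal U_\#(\mathcal P)$; $\chi(0)=\chi_*$. $\Phi^0(z)=\sum_{r=1}^R\langle\Phi_r(z+D_{y,r}\chi(z;y);y)\rangle_{y\in\mathcal P}$ for $|z|<\rho_z$, and $\delta\Phi^0,\delta^2\Phi^0$ are its derivatives. $\chi^\epsilon(z;x)=\chi(z;x/\epsilon)$, $\chi_*^\epsilon(x)=\chi_*(x/\epsilon)$; $\chi^\epsilon(Du)$ is the function $x\mapsto\chi^\epsilon(Du(x);x)$. Constants. $c_0>0$ is a coercivity constant, i.e. a number (it exists by Assumption 3) such that: $\inf_{\eta\in\mathcal U_\#(\mathcal P),|\eta|_{1,\infty}=1}\sup_{\zeta\in\mathcal U_\#(\mathcal P),|\zeta|_{1,1}=1}\sum_{r=1}^R\langle\delta^2\Phi_r(D_{y,r}\chi_*;y)D_{y,r}\eta,D_{y,r}\zeta\rangle_{\mathcal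 P}\ge2c_0$; $\inf_{w\in\mathcal U_\#(\mathcal L),|w|_{1,\infty}=1}\sup_{v\in\mathcal U_\#(\mathcal L),|v|_{1,1}=1}\sum_{r=1}^R\langle\delta^2\Phi^\epsilon_r(D_r(\epsilon\chi^\epsilon_* ))D_rw,D_rv\rangle_{\mathcal L}\ge2c_0$; and $\inf_{|w|_{1,\infty}=1}\sup_{|v|_{1,1}=1}\langle\delta^2\Phi^0(0)Dw,Dv\rangle_{\mathcal L}\ge2c_0$, $\delta^2\Phi^0(0)\ge2c_0$. $|\cdot|_{C^{0,1}}$ is the smallest Lipschitz constant, and $C^{1,1}$ means continuously differentiable with Lipschitz derivative. $C_\Phi^{(2)}=\max_{\ell=1,2}\max_{y\in\mathcal P}\sum_{r=1}^R|\delta^\ell\Phi_r(\cdot;y)|_{C^{0,1}}$ and $C_\Phi^{(1,1)}=\max_{y\in\mathcal P}\sum_{r=1}^R r\,|\delta\Phi_r(\cdot;y)|_{C^{0,1}}$ (Lipschitz constants on the intervals of Assumption 1). $\delta_fu$ is the derivative of $f\mapsto u(f)$ as a map $\mathcal U_\#^{-1,\infty}(\mathcal L)\to\mathcal U_\#^{1,\infty}(\mathcal L)$; $\|\delta_fu\|_C$ is the supremum over $B_f$ of its operator norm and $|\delta_fu|_{C^{0,1}}$ its Lipschitz constant. ''$\mathrm{Const}(a_1,\dots,a_k)$'' denotes a constant that may depend on $a_1,\dots,a_k$; it does not depend on $N$ or $f$ ($p$ and $R$ are fixed parameters of the problem). *)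

(* Defs.v *)
From mathcomp Require Export all_boot all_order all_algebra.
From mathcomp Require Export all_classical all_reals all_analysis.

Set Implicit Arguments.
Unset Strict Implicit.
Unset Printing Implicit Defensive.

Export Order.TTheory GRing.Theory Num.Theory numFieldNormedType.Exports.

Open Scope classical_set_scope.
Open Scope ring_scope.

(* Lattice functions.  A function on h*Z (h = 1 for the cell, h = 1/N for the
   macroscopic lattice) is encoded by [u : int -> R], [u k] being its value at
   the point k * h.  With this encoding chi(x / eps) at x = k * eps is the value
   at k, so that passing from eta to eta^eps is invisible.  The period is n
   lattice steps: n = p for U(P), n = N for U(L). *)

Definition eps {R : realType} (N : nat) : R := N%:R^-1.

Definition mean {R : realType} (n : nat) (u : int -> R) : R :=
  n%:R^-1 * \sum_(1 <= k < n.+1) u k%:Z.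

Definition dotp {R : realType} (n : nat) (u v : int -> R) : R :=
  mean n (fun k => u k * v k).

Definition Usharp {R : realType} (n : nat) : set (int -> R) :=
  [set u | periodic u n%:Z /\ mean n u = 0].

Definition Isharp {R : realType} (n : nat) (u : int -> R) : int -> R :=
  fun k => u k - mean n u.

Definition Diff {R : realType} (h : R) (r : nat) (u : int -> R) : int -> R :=
  fun k => (u (k + r%:Z) - u k) / (r%:R * h).

Definition norm_inf {R : realType} (n : nat) (u : int -> R) : R :=
  \big[Num.max/0]_(1 <= k < n.+1) `|u k%:Z|.

Definition norm_one {R : realType} (n : nat) (u : int -> R) : R :=
  mean n (fun k => `|u k|).

Definition snorm_inf {R : realType} (n : nat) (h : R) (m : nat)
    (u : int -> R) : R :=
  norm_inf n (iter m (Diff h 1) u).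

Definition snorm_one {R : realType} (n : nat) (h : R) (m : nat)
    (u : int -> R) : R :=
  norm_one n (iter m (Diff h 1) u).

Definition sphere_inf {R : realType} (n : nat) (h : R) : set (int -> R) :=
  [set w | Usharp n w /\ snorm_inf n h 1 w = 1].

Definition sphere_one {R : realType} (n : nat) (h : R) : set (int -> R) :=
  [set v | Usharp n v /\ snorm_one n h 1 v = 1].

(* |u|_{-1,oo}; the real-valued [sup] of the empty set is 0, as required. *)
Definition norm_dual {R : realType} (n : nat) (h : R) (u : int -> R) : R :=
  sup [set dotp n u v | v in sphere_one n h].

(* The inner suprema range over nonempty bounded sets of reals as soon as the
   outer infimum ranges over a nonempty set; the latter infimum is extended-real
   so that it is +oo over the empty set. *)
Definition infsup {R : realType} (n : nat) (h : R)
    (B : (int -> R) -> (int -> R) -> R) : \bar R :=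
  ereal_inf [set (sup [set B w v | v in sphere_one n h])%:E
            | w in sphere_inf n h].

(* Potentials: [Phi r y z] is Phi_r(z; y).  They are total functions of z, only
   the values on the balls of [assumption1] being meaningful.  A field of strains
   [s r y] gives the point at which Phi_r(.; y) is evaluated. *)

Definition potential (R : realType) := nat -> int -> R -> R.

Definition stress {R : realType} (n : nat) (h : R) (rmax : nat)
    (Phi : potential R) (s : nat -> int -> R) (v : int -> R) : R :=
  \sum_(1 <= r < rmax.+1) dotp n (fun k => derive1 (Phi r k) (s r k)) (Diff h r v).

Definition hessian {R : realType} (n : nat) (h : R) (rmax : nat)
    (Phi : potential R) (s : nat -> int -> R) (w v : int -> R) : R :=
  \sum_(1 <= r < rmax.+1)
    dotp n (fun k => derive1n 2 (Phi r k) (s r k) * Diff h r w k) (Diff h r v).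

Definition energy {R : realType} (N rmax : nat) (Phi : potential R)
    (u : int -> R) : R :=
  mean N (fun k => \sum_(1 <= r < rmax.+1) Phi r k (Diff (eps N) r u k)).

Definition dE {R : realType} (N rmax : nat) (Phi : potential R)
    (u v : int -> R) : R :=
  derive1 (fun t : R => energy N rmax Phi (u + t *: v)) 0.

Definition is_C21_on {R : realType} (A : set R) (g : R -> R) : Prop :=
  (forall z, A z -> derivable g z 1 /\ derivable (derive1 g) z 1) /\
  exists k : R, k.-lipschitz_A (derive1n 2 g).

Definition lip_const {R : realType} (A : set R) (g : R -> R) : R :=
  inf [set k : R | 0 <= k /\ k.-lipschitz_A g].

Definition domPhi {R : realType} (chis : int -> R) (rhoPhi : R)
    (r : nat) (y : int) : set R :=
  ball (Diff 1 r chis y) rhoPhi.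

Definition assumption0 {R : realType} (chis : int -> R) : Prop :=
  {homo (fun y : int => y%:~R + chis y) : x y / x < y}.

Definition assumption1 {R : realType} (rmax : nat) (Phi : potential R)
    (chis : int -> R) (rhoPhi : R) : Prop :=
  forall (r : nat) (y : int), (1 <= r <= rmax)%N ->
    is_C21_on (domPhi chis rhoPhi r y) (Phi r y).

Definition assumption2 {R : realType} (p rmax : nat) (Phi : potential R)
    (chis : int -> R) : Prop :=
  forall eta, Usharp p eta ->
    stress p 1 rmax Phi (fun r => Diff 1 r chis) eta = 0.

Definition assumption3 {R : realType} (p rmax : nat) (Phi : potential R)
    (chis : int -> R) : Prop :=
  let d2 (r : nat) (y : int) := derive1n 2 (Phi r y) (Diff 1 r chis y) in
  0 < 2^-1 * \big[Num.min/d2 1%N 1]_(1 <= y < p.+1) d2 1%N y%:Z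
      - \sum_(2 <= r < rmax.+1) \big[Num.max/0]_(1 <= y < p.+1) `|d2 r y%:Z|.

Definition C2Phi {R : realType} (p rmax : nat) (Phi : potential R)
    (chis : int -> R) (rhoPhi : R) : R :=
  let C (l : nat) := \big[Num.max/0]_(1 <= y < p.+1) \sum_(1 <= r < rmax.+1)
    lip_const (domPhi chis rhoPhi r y%:Z) (derive1n l (Phi r y%:Z)) in
  Num.max (C 1%N) (C 2%N).

Definition C11Phi {R : realType} (p rmax : nat) (Phi : potential R)
    (chis : int -> R) (rhoPhi : R) : R :=
  \big[Num.max/0]_(1 <= y < p.+1) \sum_(1 <= r < rmax.+1)
    r%:R * lip_const (domPhi chis rhoPhi r y%:Z) (derive1 (Phi r y%:Z)).

Definition cell_solution {R : realType} (p rmax : nat) (Phi : potential R)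
    (chis : int -> R) (rhochi z : R) (c : int -> R) : Prop :=
  [/\ Usharp p c, snorm_inf p 1 1 (c - chis) < rhochi &
      forall eta, Usharp p eta ->
        stress p 1 rmax Phi (fun r y => z + Diff 1 r c y) eta = 0].

Definition is_corrector {R : realType} (p rmax : nat) (Phi : potential R)
    (chis : int -> R) (rhoz rhochi : R) (chi : R -> int -> R) : Prop :=
  forall z, `|z| < rhoz ->
    cell_solution p rmax Phi chis rhochi z (chi z) /\
    forall c, cell_solution p rmax Phi chis rhochi z c -> c = chi z.

(* Meaningful only for |z| < rhoz. *)
Definition Phi0 {R : realType} (p rmax : nat) (Phi : potential R)
    (chi : R -> int -> R) (z : R) : R :=
  \sum_(1 <= r < rmax.+1) mean p (fun y => Phi r y (z + Diff 1 r (chi z) y)).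

Definition homogenized_hessian {R : realType} (N p rmax : nat)
    (Phi : potential R) (chi : R -> int -> R) (w v : int -> R) : R :=
  dotp N (fun k => derive1n 2 (Phi0 p rmax Phi chi) 0 * Diff (eps N) 1 w k)
         (Diff (eps N) 1 v).

Definition cell_coercive {R : realType} (p rmax : nat) (Phi : potential R)
    (chis : int -> R) (chi : R -> int -> R) (c0 : R) : Prop :=
  ((2 * c0)%:E
     <= infsup p 1 (hessian p 1 rmax Phi (fun r => Diff 1 r chis)))%E /\
  2 * c0 <= derive1n 2 (Phi0 p rmax Phi chi) 0.

Definition lattice_coercive {R : realType} (N p rmax : nat) (Phi : potential R)
    (chis : int -> R) (chi : R -> int -> R) (c0 : R) : Prop :=
  ((2 * c0)%:E
     <= infsup N (eps N) (hessian N (eps N) rmax Phi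
          (fun r => Diff (eps N) r (eps N *: chis))))%E /\
  ((2 * c0)%:E
     <= infsup N (eps N) (homogenized_hessian N p rmax Phi chi))%E.

Definition atomistic_solution {R : realType} (N rmax : nat) (Phi : potential R)
    (f u : int -> R) : Prop :=
  forall v, Usharp N v -> dE N rmax Phi u v = dotp N f v.

Definition homogenized_solution {R : realType} (N p rmax : nat)
    (Phi : potential R) (chi : R -> int -> R) (f u0 : int -> R) : Prop :=
  forall v, Usharp N v ->
    dotp N (fun k => derive1 (Phi0 p rmax Phi chi) (Diff (eps N) 1 u0 k))
           (Diff (eps N) 1 v) = dotp N f v.

Definition corrected {R : realType} (N : nat) (chi : R -> int -> R)
    (u0 : int -> R) : int -> R :=
  Isharp N (fun k => u0 k + eps N * chi (Diff (eps N) 1 u0 k) k).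

Definition ball_f {R : realType} (N : nat) (rhof : R) : set (int -> R) :=
  [set f | Usharp N f /\ norm_dual N (eps N) f < rhof].

Definition ball_star {R : realType} (N : nat) (chis : int -> R) (rhou : R) :
    set (int -> R) :=
  [set u | Usharp N u /\ snorm_inf N (eps N) 1 (u - eps N *: chis) < rhou].

Definition ball_zero {R : realType} (N : nat) (rhou : R) : set (int -> R) :=
  [set u | Usharp N u /\ snorm_inf N (eps N) 1 u < rhou].

Definition unique_solution_map {R : realType} (Bf Bu : set (int -> R))
    (sol : (int -> R) -> (int -> R) -> Prop)
    (F : (int -> R) -> (int -> R)) : Prop :=
  forall f, Bf f ->
    [/\ Bu (F f), sol f (F f) & forall w, Bu w -> sol f w -> w = F f].

(* Calculus of maps from U_#^{-1,oo}(L) to U_#^{1,oo}(L).  Linear operators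
   between these spaces are encoded by functions on int -> R of which only the
   restriction to U_#(L) matters. *)

Definition linear_on_Usharp {R : realType} (N : nat)
    (T : (int -> R) -> (int -> R)) : Prop :=
  (forall g, Usharp N g -> Usharp N (T g)) /\
  (forall (a : R) g h, Usharp N g -> Usharp N h ->
     T (a *: g + h) = a *: T g + T h).

Definition is_Frechet_deriv {R : realType} (N : nat)
    (F : (int -> R) -> (int -> R)) (f : int -> R)
    (T : (int -> R) -> (int -> R)) : Prop :=
  linear_on_Usharp N T /\
  forall e : R, 0 < e -> exists2 d : R, 0 < d &
    forall g, Usharp N g -> norm_dual N (eps N) g < d ->
      snorm_inf N (eps N) 1 (F (f + g) - F f - T g)
        <= e * norm_dual N (eps N) g.

Definition opnorm {R : realType} (N : nat) (T : (int -> R) -> (int -> R)) :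
    \bar R :=
  ereal_sup [set (snorm_inf N (eps N) 1 (T g))%:E
            | g in [set g | Usharp N g /\ norm_dual N (eps N) g <= 1]].

Definition deriv_normC {R : realType} (N : nat) (Bf : set (int -> R))
    (dF : (int -> R) -> (int -> R) -> (int -> R)) : \bar R :=
  ereal_sup [set opnorm N (dF f) | f in Bf].

Definition deriv_lip {R : realType} (N : nat) (Bf : set (int -> R))
    (dF : (int -> R) -> (int -> R) -> (int -> R)) : \bar R :=
  ereal_inf [set L%:E | L in [set L : R | 0 <= L /\
    forall f g, Bf f -> Bf g ->
      (opnorm N (fun h => (dF f h - dF g h)%R)
         <= (L * norm_dual N (eps N) (f - g))%:E)%E]].

Definition is_C11 {R : realType} (N : nat) (Bf : set (int -> R))
    (F : (int -> R) -> (int -> R))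
    (dF : (int -> R) -> (int -> R) -> (int -> R)) : Prop :=
  (forall f, Bf f -> is_Frechet_deriv N F f (dF f)) /\
  (deriv_lip N Bf dF < +oo)%E.

(* Main.v *)
Require Import Defs.
From mathcomp Require Import ring lra zify.

Set Implicit Arguments.
Unset Strict Implicit.
Unset Printing Implicit Defensive.

(* Everything is expressed through gradients: a lattice functional
   sum_r <s_r, D_r v> is bounded by the sup norm of the stresses s_r times the
   L^1 norm of Dv, so Lipschitz second derivatives make the equilibrium map C^{1,1}
   from |.|_{1,oo} to |.|_{-1,oo}, uniformly in N.  The inf-sup condition at the
   reference state survives on a ball of fixed radius; a Newton iteration with
   frozen Hessian (the linear problems being square, injectivity suffices) gives
   existence, and the inf-sup condition gives uniqueness, |delta_f u| <= 1/c0 and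
   the Lipschitz bound.  This one argument is applied to the atomistic problem, to
   the homogenized problem (range one, potential Phi^0) and to the cell problem,
   where it identifies chi(z) near z = 0 with a C^{1,1} branch; this makes Phi^0
   twice differentiable with Lipschitz second derivative.
   For the error estimate, the averaged stress at k of the corrected solution
   differs by O(eps |u0|_{2,oo}) from the one obtained by freezing the macroscopic
   strain at Du0(k); the latter is constant by the cell equation and equals
   dPhi^0(Du0(k)). *)

(** * Lattice functions *)

Section lattice.
Context {R : realType}.
Implicit Types (u v w : int -> R) (n m r : nat) (h c M : R) (k q : int).

(** The difficulty is uniformity in N. Inverse inequalities between lattice norms carry factors of
    N, so they serve only for finiteness and for passing to limits; every quantitative step stays in
    the pair |.|_{1,oo}, |.|_{-1,oo}, where differences of any range cost no more than
    nearest-neighbour ones. The inf-sup constant is given as 2 c0 so that one c0 can be spent on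
    freezing the stiffness at the reference state; this fixes a radius independent of N. The force
    law enters as a site-dependent pair (force, stiffness) rather than as a potential, which lets
    the three problems share one argument. The corrector is assumed to exist and to be unique, not
    to be smooth in z, so its regularity has to be recovered from the cell problem before Phi^0 can
    be differentiated. Two Lipschitz constants of the corrector are tracked: the one from C_Phi^(2)
    enters the radii and the smoothness of Phi^0, the one from C_Phi^(1,1) the error constants,
    which may depend on C_Phi^(1,1)/c0 alone. *)

Lemma periodic_mulz (T : Type) (u : int -> T) n k q :
  (forall j, u (j + n%:Z) = u j) -> u (k + q * n%:Z) = u k.
Proof.
move=> hu; have pos (i : nat) k' : u (k' + i%:Z * n%:Z) = u k'.
  elim: i => [|i ih]; first by rewrite mul0r addr0.
  by rewrite -ih -[RHS]hu; congr u; lia.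
case: q => i; first exact: pos.
by rewrite -(pos i.+1 (k + Negz i * n%:Z)); congr u; lia.
Qed.

(** The representative is sought in 1..n, the range of [mean] and [norm_inf], hence the division of
    k - 1 rather than of k. *)
Lemma int_rep n k : (0 < n)%N ->
  exists (j : nat) q, (1 <= j < n.+1)%N /\ k = j%:Z + q * n%:Z.
Proof.
move=> n0; have [q [t [e t0 tn]]] : exists q t : int,
    [/\ k - 1 = q * n%:Z + t, 0 <= t & t < n%:Z].
  exists ((k - 1) %/ n%:Z)%Z, ((k - 1) %% n%:Z)%Z; split.
  - exact: divz_eq.
  - by apply: modz_ge0; lia.
  - by apply: ltz_pmod; lia.
by case: t e t0 tn => // t e _ tn; exists t.+1, q; split; lia.
Qed.

Lemma periodic_rep n u k : (0 < n)%N -> periodic u n%:Z ->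
  exists2 j : nat, (1 <= j < n.+1)%N & u k = u j%:Z.
Proof.
move=> n0 hu; have [j [q [jn ->]]] := int_rep k n0.
by exists j => //; exact: periodic_mulz.
Qed.

Lemma mean_eq n u v : (forall k, u k = v k) -> mean n u = mean n v.
Proof. by move=> e; rewrite /mean; congr (_ * _); apply: eq_bigr => k _. Qed.

Lemma meanD n u v : mean n (fun k => u k + v k) = mean n u + mean n v.
Proof. by rewrite /mean big_split /= mulrDr. Qed.

Lemma meanZ n c u : mean n (fun k => c * u k) = c * mean n u.
Proof. by rewrite /mean -mulr_sumr mulrCA. Qed.

Lemma meanB n u v : mean n (fun k => u k - v k) = mean n u - mean n v.
Proof. by rewrite /mean sumrB mulrBr. Qed.

Lemma mean_cst n c : (0 < n)%N -> mean n (fun=> c) = c.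
Proof.
move=> n0; rewrite /mean big_const_nat subSS subn0 iter_addr_0 -(mulr_natl c) mulrA.
by rewrite mulVf ?mul1r // pnatr_eq0 -lt0n.
Qed.

Lemma mean0 n : mean n (fun=> 0 : R) = 0.
Proof. by rewrite /mean big1 ?mulr0. Qed.

Lemma mean_le n u v : (forall k, u k <= v k) -> mean n u <= mean n v.
Proof.
by move=> uv; rewrite /mean ler_wpM2l ?invr_ge0 ?ler0n// ler_sum.
Qed.

Lemma mean_ge0 n u : (forall k, 0 <= u k) -> 0 <= mean n u.
Proof. by move=> u0; rewrite -(mean0 n); exact: mean_le. Qed.

Lemma mean_norm n u : `|mean n u| <= mean n (fun k => `|u k|).
Proof.
rewrite /mean normrM ger0_norm ?invr_ge0 ?ler0n//.
by rewrite ler_wpM2l ?invr_ge0 ?ler0n// ler_norm_sum.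
Qed.

Lemma mean_sum n (I : Type) (s : seq I) (F : I -> int -> R) :
  mean n (fun k => \sum_(i <- s) F i k) = \sum_(i <- s) mean n (F i).
Proof. by rewrite /mean exchange_big /= mulr_sumr. Qed.

Lemma periodic_shift n u q : periodic u n%:Z -> periodic (fun k => u (k + q)) n%:Z.
Proof. by move=> hu k; rewrite addrAC hu. Qed.

Lemma mean_shift1 n u : periodic u n%:Z -> mean n (fun k => u (k + 1)) = mean n u.
Proof.
move=> hu; rewrite /mean; congr (_ * _).
case: n hu => [|n] hu; first by rewrite !big_geq.
rewrite big_nat_recr//= [RHS]big_nat_recl//=; rewrite addrC; congr (_ + _).
  by rewrite -(hu 1%:Z); congr u; lia.
by apply: eq_bigr => i _; congr u; lia.
Qed.

Lemma mean_shift n u q : periodic u n%:Z -> mean n (fun k => u (k + q)) = mean n u.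
Proof.
move=> hu; have pos (i : nat) v : periodic v n%:Z ->
    mean n (fun k => v (k + i%:Z)) = mean n v.
  move=> hv; elim: i => [|i ih]; first by apply: mean_eq => k; rewrite addr0.
  rewrite -ih -[RHS]mean_shift1; last exact: periodic_shift.
  by apply: mean_eq => k; congr v; lia.
case: q => i; first exact: pos.
rewrite -(pos i.+1); last exact: periodic_shift.
by apply: mean_eq => k; congr u; lia.
Qed.

Lemma DiffE h r u k : Diff h r u k = (u (k + r%:Z) - u k) / (r%:R * h).
Proof. by []. Qed.

Lemma Diff1E h u k : Diff h 1 u k = (u (k + 1) - u k) / h.
Proof. by rewrite DiffE mul1r. Qed.

Lemma DiffD h r u v : Diff h r (u + v) = Diff h r u + Diff h r v.
Proof.
by apply/funext => k; rewrite /Diff !fctE -mulrDl; congr (_ / _); ring.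
Qed.

Lemma DiffB h r u v : Diff h r (u - v) = Diff h r u - Diff h r v.
Proof.
by apply/funext => k; rewrite /Diff !fctE -mulrBl; congr (_ / _); ring.
Qed.

Lemma DiffBE h r u v k : Diff h r (u - v) k = Diff h r u k - Diff h r v k.
Proof. by rewrite DiffB. Qed.

Lemma DiffZ h r c u : Diff h r (c *: u) = c *: Diff h r u.
Proof.
apply/funext => k; rewrite /Diff !fctE /GRing.scale /=.
by rewrite -mulrBr -mulrA.
Qed.

Lemma Diff_cst h r c : Diff h r (fun=> c) = fun=> 0.
Proof. by apply/funext => k; rewrite /Diff subrr mul0r. Qed.

Lemma Diff0 h r : Diff h r (0 : int -> R) = 0.
Proof. exact: Diff_cst. Qed.

Lemma Diff_periodic n h r u : periodic u n%:Z -> periodic (Diff h r u) n%:Z.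
Proof. by move=> hu k; rewrite /Diff addrAC !hu. Qed.

Lemma mean_Diff n h r u : periodic u n%:Z -> mean n (Diff h r u) = 0.
Proof.
move=> hu; have -> : Diff h r u = fun k => (r%:R * h)^-1 * (u (k + r%:Z) - u k).
  by apply/funext => k; rewrite /Diff mulrC.
by rewrite meanZ meanB mean_shift// subrr mulr0.
Qed.

(** Telescoping. As an average of nearest-neighbour differences, a difference of range r is bounded
    by them with constant 1, both in the sup norm and in L^1. *)
Lemma Diff_avg h r u k : (0 < r)%N ->
  Diff h r u k = r%:R^-1 * \sum_(0 <= i < r) Diff h 1 u (k + i%:Z).
Proof.
move=> r0; rewrite /Diff; under eq_bigr do rewrite mul1r.
rewrite -mulr_suml (eq_bigr (fun i : nat => u (k + i.+1%:Z) - u (k + i%:Z))).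
  rewrite telescope_sumr// addr0; rewrite invfM; ring.
by move=> i _; congr (u _ - _); lia.
Qed.

Lemma norm_inf_le n u M : 0 <= M -> (forall k, `|u k| <= M) -> norm_inf n u <= M.
Proof. by move=> M0 uM; apply: bigmax_le. Qed.

Lemma norm_inf_ge0 n u : 0 <= norm_inf n u.
Proof. by apply: bigmax_ge_id. Qed.

Lemma le_norm_inf n u k : (0 < n)%N -> periodic u n%:Z -> `|u k| <= norm_inf n u.
Proof.
move=> n0 hu; have [j jn ->] := periodic_rep k n0 hu.
rewrite /norm_inf; by apply: (le_bigmax_seq 0 j xpredT (fun j : nat => `|u j%:Z|)) => //; rewrite mem_index_iota.
Qed.

Lemma snorm_inf1E n h u : snorm_inf n h 1 u = norm_inf n (Diff h 1 u).
Proof. by []. Qed.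

Lemma snorm_one1E n h u : snorm_one n h 1 u = mean n (fun k => `|Diff h 1 u k|).
Proof. by []. Qed.

Lemma snorm_inf_ge0 n h m u : 0 <= snorm_inf n h m u.
Proof. exact: norm_inf_ge0. Qed.

Lemma snorm_one_ge0 n h m u : 0 <= snorm_one n h m u.
Proof. by apply: mean_ge0 => k. Qed.

Lemma Diff_le n h r u k : (0 < n)%N -> periodic u n%:Z -> (0 < r)%N ->
  `|Diff h r u k| <= snorm_inf n h 1 u.
Proof.
move=> n0 hu r0; rewrite Diff_avg// normrM ger0_norm ?invr_ge0 ?ler0n//.
rewrite -ler_pdivlMl ?invr_gt0 ?ltr0n// invrK.
apply: (le_trans (ler_norm_sum _ _ _)).
apply: (@le_trans _ _ (\sum_(0 <= i < r) snorm_inf n h 1 u)).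
  by apply: ler_sum => i _; exact/le_norm_inf/Diff_periodic.
by rewrite big_const_nat subn0 iter_addr_0 mulr_natl.
Qed.

Lemma mean_Diff_le n h r v : periodic v n%:Z -> (0 < r)%N ->
  mean n (fun k => `|Diff h r v k|) <= snorm_one n h 1 v.
Proof.
move=> hv r0; pose F (i : nat) k := `|Diff h 1 v (k + i%:Z)|.
apply: (@le_trans _ _ (mean n (fun k => r%:R^-1 * \sum_(0 <= i < r) F i k))).
  apply: mean_le => k; rewrite Diff_avg// normrM ger0_norm ?invr_ge0 ?ler0n//.
  by rewrite ler_wpM2l ?invr_ge0 ?ler0n// ler_norm_sum.
rewrite meanZ mean_sum (eq_bigr (fun=> snorm_one n h 1 v)).
  rewrite big_const_nat subn0 iter_addr_0 -[X in _ * X]mulr_natl mulrA mulVf ?mul1r//.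
  by rewrite pnatr_eq0 -lt0n.
move=> i _; rewrite snorm_one1E /F.
rewrite (@mean_shift n (fun k => `|Diff h 1 v k|))// => k.
by rewrite /= Diff_periodic.
Qed.

(* Going from [k] to [k + i] around either side of the period. *)
Lemma Usharp_sup_le n h u k : (0 < n)%N -> 0 < h -> Usharp n u ->
  2 * `|u k| <= n%:R * h * snorm_inf n h 1 u.
Proof.
move=> n0 h0 [hu mu]; set X := snorm_inf n h 1 u.
have step (i : nat) k' : `|u (k' + i%:Z) - u k'| <= i%:R * h * X.
  case: i => [|i]; first by rewrite addr0 subrr normr0 !mul0r.
  have := Diff_le h k' n0 hu (ltn0Sn i); rewrite /Diff normrM normfV.
  have p0 : (0:R) < i.+1%:R * h by rewrite mulr_gt0// ltr0n.
  by rewrite (gtr0_norm p0) ler_pdivrMr// mulrC.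
have half (i : nat) : (i <= n)%N -> 2 * `|u (k + i%:Z) - u k| <= n%:R * h * X.
  move=> ile; have s1 := step i k; have s2 := step (n - i)%N (k + i%:Z).
  have e : u (k + i%:Z + (n - i)%N%:Z) = u k.
    by rewrite -(hu k); congr u; lia.
  rewrite e distrC natrB// in s2.
  have -> : n%:R * h * X = i%:R * h * X + (n%:R - i%:R) * h * X by ring.
  lra.
(* Zero mean turns u k into an average of differences, to each of which [half] applies. *)
have -> : u k = - mean n (fun j => u (j + k) - u k).
  by rewrite meanB mean_shift// mu mean_cst// sub0r opprK.
rewrite normrN -{1}(@ger0_norm _ 2)// -normrM -meanZ.
apply: (le_trans (mean_norm _ _)).
rewrite -[leRHS](mean_cst _ n0) /mean ler_wpM2l ?invr_ge0 ?ler0n//.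
rewrite big_nat [leRHS]big_nat ler_sum// => i /andP[_ il].
by rewrite normrM ger0_norm// [_ + k]addrC; apply: half; rewrite -ltnS.
Qed.

(** An inverse inequality: one term is at most the whole sum. Its factor n is harmless because it is
    used only to show that a supremum is finite and that a seminorm vanishes on 0 alone. *)
Lemma snorm_inf_le_one n h u : (0 < n)%N ->
  snorm_inf n h 1 u <= n%:R * snorm_one n h 1 u.
Proof.
move=> n0; rewrite snorm_one1E /mean mulrA divff ?mul1r ?pnatr_eq0 -?lt0n//.
rewrite snorm_inf1E /norm_inf big_nat; apply: bigmax_le => [|i il]; first exact: sumr_ge0.
rewrite (big_rem i) ?mem_index_iota//= lerDl sumr_ge0//.
Qed.

Lemma Usharp0 n : Usharp n (0 : int -> R).
Proof. by split=> //; exact: mean0. Qed.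

Lemma UsharpD n u v : Usharp n u -> Usharp n v -> Usharp n (u + v).
Proof.
move=> [hu mu] [hv mv]; split=> [k|]; first by rewrite !fctE hu hv.
by rewrite meanD mu mv addr0.
Qed.

Lemma UsharpZ n c u : Usharp n u -> Usharp n (c *: u).
Proof.
move=> [hu mu]; split=> [k|]; first by rewrite !fctE hu.
by rewrite -[LHS]/(mean n (fun k => c * u k)) meanZ mu mulr0.
Qed.

Lemma UsharpN n u : Usharp n u -> Usharp n (- u).
Proof. by rewrite -scaleN1r; exact: UsharpZ. Qed.

Lemma UsharpB n u v : Usharp n u -> Usharp n v -> Usharp n (u - v).
Proof. by move=> hu hv; apply/UsharpD/UsharpN. Qed.

Lemma Usharp_Isharp n u : (0 < n)%N -> periodic u n%:Z -> Usharp n (Isharp n u).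
Proof.
move=> n0 hu; split=> [k|]; first by rewrite /Isharp hu.
by rewrite /Isharp meanB mean_cst// subrr.
Qed.

Lemma Diff_Isharp n h r u : Diff h r (Isharp n u) = Diff h r u.
Proof. by apply/funext => k; rewrite /Diff /Isharp opprB addrA subrK. Qed.

Lemma snorm_infZ n h c u : (0 < n)%N -> periodic u n%:Z ->
  snorm_inf n h 1 (c *: u) <= `|c| * snorm_inf n h 1 u.
Proof.
move=> n0 hu; rewrite snorm_inf1E DiffZ.
apply: norm_inf_le; first by rewrite mulr_ge0// snorm_inf_ge0.
move=> k; rewrite [X in X <= _](_ : _ = `|c| * `|Diff h 1 u k|); last exact: normrM.
by rewrite ler_wpM2l// le_norm_inf//; exact: Diff_periodic.
Qed.

Lemma snorm_infD n h u v : (0 < n)%N -> periodic u n%:Z -> periodic v n%:Z ->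
  snorm_inf n h 1 (u + v) <= snorm_inf n h 1 u + snorm_inf n h 1 v.
Proof.
move=> n0 hu hv; rewrite snorm_inf1E DiffD.
apply: norm_inf_le; first by rewrite addr_ge0// snorm_inf_ge0.
move=> k; apply: (le_trans (ler_normD _ _)).
by rewrite lerD// le_norm_inf//; exact: Diff_periodic.
Qed.

Lemma snorm_infN n h u : snorm_inf n h 1 (- u) = snorm_inf n h 1 u.
Proof.
rewrite !snorm_inf1E /norm_inf; apply: eq_bigr => k _.
by rewrite -scaleN1r DiffZ -[RHS]normrN; congr (`|_|); exact: mulN1r.
Qed.

Lemma snorm_infC n h u v : snorm_inf n h 1 (u - v) = snorm_inf n h 1 (v - u).
Proof. by rewrite -snorm_infN opprB. Qed.

Lemma snorm_inf0 n h : snorm_inf n h 1 (0 : int -> R) = 0.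
Proof.
apply/eqP; rewrite eq_le snorm_inf_ge0 andbT; apply: norm_inf_le => // k.
by rewrite /= Diff0 normr0.
Qed.

Lemma snorm_oneZ n h c v : snorm_one n h 1 (c *: v) = `|c| * snorm_one n h 1 v.
Proof.
by rewrite !snorm_one1E DiffZ -meanZ; apply: mean_eq => k; exact: normrM.
Qed.

Lemma Usharp_eq0 n h u : (0 < n)%N -> 0 < h -> Usharp n u ->
  snorm_inf n h 1 u <= 0 -> u = 0.
Proof.
move=> n0 h0 hu X0; apply/funext => k; apply/normr0_eq0/eqP.
have := Usharp_sup_le k n0 h0 hu.
have -> : snorm_inf n h 1 u = 0 by apply/eqP; rewrite eq_le X0 snorm_inf_ge0.
by rewrite mulr0 => H; rewrite eq_le normr_ge0 andbT; lra.
Qed.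

Lemma Usharp_eq0_one n h u : (0 < n)%N -> 0 < h -> Usharp n u ->
  snorm_one n h 1 u = 0 -> u = 0.
Proof.
move=> n0 h0 hu X0; apply: (Usharp_eq0 n0 h0 hu).
by apply: (le_trans (snorm_inf_le_one _ _ n0)); rewrite X0 mulr0.
Qed.

End lattice.

(** * Linear functionals on gradients *)

Section core.
Context {R : realType}.
Implicit Types (u v w f : int -> R) (n m r : nat) (h c M : R) (k q : int).
Implicit Types (s t : nat -> int -> R).

(** Common form of first and second variations: s is a stress field for the former, stiffness times
    [Diff h r w] for the latter. *)
Definition core n h m s v : R :=
  \sum_(1 <= r < m.+1) dotp n (s r) (Diff h r v).

Definition lin (l : (int -> R) -> R) :=
  forall c u v, l (c *: u + v) = c * l u + l v.

Lemma dotpDl n u v w : dotp n (u + v) w = dotp n u w + dotp n v w.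
Proof. by rewrite /dotp -meanD; apply: mean_eq => k; rewrite !fctE mulrDl. Qed.

Lemma dotpBl n u v w : dotp n (u - v) w = dotp n u w - dotp n v w.
Proof. by rewrite /dotp -meanB; apply: mean_eq => k; rewrite !fctE mulrBl. Qed.

Lemma dotpC n u v : dotp n u v = dotp n v u.
Proof. by apply: mean_eq => k; rewrite mulrC. Qed.

Lemma dotpZl n c u v : dotp n (c *: u) v = c * dotp n u v.
Proof. by rewrite /dotp -meanZ; apply: mean_eq => k; rewrite !fctE mulrA. Qed.

Lemma dotp_lin n u : lin (dotp n u).
Proof. by move=> c v w; rewrite dotpC dotpDl dotpZl !(dotpC n u). Qed.

Lemma core_lin n h m s : lin (core n h m s).
Proof.
move=> c u v; rewrite /core mulr_sumr -big_split /=; apply: eq_bigr => r _.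
by rewrite DiffD DiffZ dotp_lin.
Qed.

Lemma eq_core n h m s t v :
  (forall r k, (1 <= r <= m)%N -> s r k = t r k) -> core n h m s v = core n h m t v.
Proof.
move=> e; rewrite /core big_nat [RHS]big_nat; apply: eq_bigr => r hr.
by apply: mean_eq => k; rewrite e.
Qed.

Lemma coreD n h m s t v :
  core n h m (fun r k => s r k + t r k) v = core n h m s v + core n h m t v.
Proof. by rewrite /core -big_split; apply: eq_bigr => r _; exact: dotpDl. Qed.

Lemma coreZ n h m c s v :
  core n h m (fun r k => c * s r k) v = c * core n h m s v.
Proof. by rewrite /core mulr_sumr; apply: eq_bigr => r _; exact: dotpZl. Qed.

Lemma coreB n h m s t v :
  core n h m (fun r k => s r k - t r k) v = core n h m s v - core n h m t v.
Proof. by rewrite /core -sumrB; apply: eq_bigr => r _; exact: dotpBl. Qed.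

Lemma core_Diff_linl n h m s v : lin (fun w => core n h m (fun r k => s r k * Diff h r w k) v).
Proof.
move=> c u w; rewrite -coreZ -coreD; apply: eq_core => r k _.
by rewrite DiffD DiffZ !fctE /GRing.scale /=; ring.
Qed.

Lemma core_le n h m s v M : 0 <= M -> periodic v n%:Z ->
  (forall r k, (1 <= r <= m)%N -> `|s r k| <= M) ->
  `|core n h m s v| <= m%:R * M * snorm_one n h 1 v.
Proof.
move=> M0 hv sM; rewrite /core big_nat.
apply: (le_trans (ler_norm_sum _ _ _)).
apply: (@le_trans _ _ (\sum_(1 <= r < m.+1 | (1 <= r < m.+1)%N) M * snorm_one n h 1 v)).
  apply: ler_sum => r /andP[r1 rm]; apply: (le_trans (mean_norm _ _)).
  apply: (@le_trans _ _ (mean n (fun k => M * `|Diff h r v k|))).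
    by apply: mean_le => k; rewrite normrM ler_wpM2r// sM// r1.
  by rewrite meanZ ler_wpM2l// mean_Diff_le.
by rewrite -big_nat big_const_nat subSS subn0 iter_addr_0 -mulrA [leRHS]mulr_natl.
Qed.

(** M bounds the |.|_{-1,oo} norm of l. The bound is one-sided, as v may be replaced by -v for
    linear l, and homogeneous, so that an empty unit sphere needs no separate treatment. *)
Definition dbound n h (l : (int -> R) -> R) M :=
  0 <= M /\ forall v, Usharp n v -> l v <= M * snorm_one n h 1 v.

Lemma eq_dbound n h l l' M : (forall v, Usharp n v -> l v = l' v) ->
  dbound n h l M -> dbound n h l' M.
Proof. by move=> e [M0 lM]; split=> // v hv; rewrite -e// lM. Qed.

Lemma dboundD n h l l' M M' : dbound n h l M -> dbound n h l' M' ->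
  dbound n h (fun v => l v + l' v) (M + M').
Proof.
move=> [M0 lM] [M'0 lM']; split=> [|v hv]; first exact: addr_ge0.
by rewrite mulrDl lerD// ?lM ?lM'.
Qed.

Lemma dbound_weak n h l M M' : M <= M' -> dbound n h l M -> dbound n h l M'.
Proof.
move=> MM' [M0 lM]; split=> [|v hv]; first exact: le_trans MM'.
by apply: (le_trans (lM v hv)); rewrite ler_wpM2r// snorm_one_ge0.
Qed.

Lemma lin0 l : lin l -> l 0 = 0.
Proof. by move=> ll; have := ll (-1) 0 0; rewrite scaler0 addr0 => ->; ring. Qed.

Lemma linZ l c u : lin l -> l (c *: u) = c * l u.
Proof. by move=> ll; rewrite -[c *: u]addr0 ll lin0// addr0. Qed.

Lemma linN l u : lin l -> l (- u) = - l u.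
Proof. by move=> ll; rewrite -scaleN1r linZ// mulN1r. Qed.

Lemma linD l u v : lin l -> l (u + v) = l u + l v.
Proof. by move=> ll; rewrite -[u]scale1r ll mul1r scale1r. Qed.

Lemma linB l u v : lin l -> l (u - v) = l u - l v.
Proof. by move=> ll; rewrite linD// linN. Qed.

Lemma lin_sum l m (x : 'I_m -> R) (e : 'I_m -> int -> R) : lin l ->
  l (\sum_(i < m) x i *: e i) = \sum_(i < m) x i * l (e i).
Proof.
move=> ll; apply: (big_rec2 (fun (a : int -> R) b => l a = b)); first exact: lin0.
by move=> i a b _ ab; rewrite ll ab.
Qed.

Lemma dbound_opp n h l M : lin l -> dbound n h l M -> dbound n h (fun v => - l v) M.
Proof.
move=> ll [M0 lM]; split=> // v hv; rewrite -linN//.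
have -> : snorm_one n h 1 v = snorm_one n h 1 (- v).
  by rewrite -scaleN1r snorm_oneZ normrN1 mul1r.
by apply/lM/UsharpN.
Qed.

Lemma dbound_core n h m s M : 0 <= M ->
  (forall r k, (1 <= r <= m)%N -> `|s r k| <= M) ->
  dbound n h (core n h m s) (m%:R * M).
Proof.
move=> M0 sM; split=> [|v [hv _]]; first exact: mulr_ge0.
exact: (le_trans (ler_norm _) (core_le _ M0 hv sM)).
Qed.

(** The inf-sup condition read as an a priori bound for the linear problem with stiffness s. *)
Definition stable n h m s c := forall w M, Usharp n w ->
  dbound n h (core n h m (fun r k => s r k * Diff h r w k)) M ->
  c * snorm_inf n h 1 w <= M.

Lemma snorm_infZE n h c u : (0 < n)%N -> periodic u n%:Z ->
  snorm_inf n h 1 (c *: u) = `|c| * snorm_inf n h 1 u.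
Proof.
move=> n0 hu; apply/eqP; rewrite eq_le snorm_infZ//=.
have [->|c0] := eqVneq c 0; first by rewrite normr0 mul0r snorm_inf_ge0.
rewrite -ler_pdivlMl ?normr_gt0// -normfV.
rewrite -[X in X <= _](_ : snorm_inf n h 1 (c^-1 *: (c *: u)) = _).
  by apply: snorm_infZ => // k; rewrite !fctE hu.
by rewrite scalerA mulVf// scale1r.
Qed.

(** Normalise w and use the infimum at that point. An empty sphere of test functions gives supremum
    0, which M >= 0 covers. *)
Lemma infsup_stable n h m s (B : (int -> R) -> (int -> R) -> R) c :
  (0 < n)%N ->
  (forall w v, B w v = core n h m (fun r k => s r k * Diff h r w k) v) ->
  (c%:E <= infsup n h B)%E -> stable n h m s c.
Proof.
move=> n0 BE cB w M hw [M0 wM]; set X := snorm_inf n h 1 w.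
have [->|Xn0] := eqVneq X 0; first by rewrite mulr0.
have X0 : 0 < X by rewrite lt_def Xn0 snorm_inf_ge0.
pose w' := X^-1 *: w.
have w'S : sphere_inf n h w'.
  split; first exact: UsharpZ.
  by rewrite /= /w' (snorm_infZE h X^-1 n0 (proj1 hw)) gtr0_norm ?invr_gt0// mulVf.
have : (c%:E <= (sup [set B w' v | v in sphere_one n h])%:E)%E.
  by apply: (le_trans cB); apply: ereal_inf_lbound; exists w'.
rewrite lee_fin -ler_pdivlMr// => /le_trans; apply.
have [[x Sx]|] := pselect ([set B w' v | v in sphere_one n h] !=set0); last first.
  move=> /set0P/negP/negPn/eqP ->.
  by rewrite sup0 divr_ge0// ltW.
apply: ge_sup; first by exists x.
move=> _ [v [hv v1] <-]; rewrite BE.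
have := linZ X^-1 w (core_Diff_linl n h m s v) => ->.
by rewrite mulrC ler_pM2r ?invr_gt0//; have := wM v hv; rewrite v1 mulr1.
Qed.

(** A crude bound, whose only purpose is that the supremum defining [norm_dual] is finite. *)
Lemma dotp_le n h f v : (0 < n)%N -> 0 < h -> Usharp n v ->
  `|dotp n f v| <= norm_inf n f * (n%:R * h * n%:R) * snorm_one n h 1 v.
Proof.
move=> n0 h0 hv; apply: (le_trans (mean_norm _ _)).
set F := norm_inf n f; set S := snorm_one _ _ _ _.
have F0 : 0 <= F by exact: norm_inf_ge0.
have vS k : `|v k| <= n%:R * h * n%:R * S.
  apply: (@le_trans _ _ (n%:R * h * snorm_inf n h 1 v)).
    by have := Usharp_sup_le k n0 h0 hv; have := normr_ge0 (v k); lra.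
  by rewrite -[leRHS]mulrA ler_wpM2l ?mulr_ge0 ?ler0n ?(ltW h0)// snorm_inf_le_one.
have n1 : n%:R != 0 :> R by rewrite pnatr_eq0 -lt0n.
rewrite /mean -[leRHS](mulKf n1) ler_wpM2l ?invr_ge0 ?ler0n//.
rewrite [leRHS](_ : _ = \sum_(1 <= k < n.+1) (F * (n%:R * h * n%:R) * S)); last first.
  by rewrite big_const_nat subSS subn0 iter_addr_0 -[RHS]mulr_natl.
rewrite big_nat [leRHS]big_nat ler_sum// => k kn; rewrite normrM -mulrA ler_pM//.
by apply: (le_bigmax_seq 0 k xpredT (fun j : nat => `|f j%:Z|)) => //; rewrite mem_index_iota.
Qed.

Lemma dual_ub n h f : (0 < n)%N -> 0 < h ->
  has_ubound [set dotp n f v | v in sphere_one n h].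
Proof.
move=> n0 h0; exists (norm_inf n f * (n%:R * h * n%:R)) => _ [v [hv v1] <-].
by apply: (le_trans (ler_norm _)); have := dotp_le f n0 h0 hv; rewrite v1 mulr1.
Qed.

Lemma norm_dual_ge0 n h f : (0 < n)%N -> 0 < h -> 0 <= norm_dual n h f.
Proof.
move=> n0 h0; rewrite /norm_dual.
have [[x [v [hv v1] fv]]|] := pselect ([set dotp n f v | v in sphere_one n h] !=set0).
  have le v' : sphere_one n h v' -> dotp n f v' <= norm_dual n h f.
    by move=> hv'; apply: ub_le_sup; [exact: dual_ub|exists v'].
  have l1 := le v (conj hv v1).
  have hN : sphere_one n h (- v).
    by split; [exact: UsharpN|rewrite -scaleN1r snorm_oneZ normrN1 mul1r].
  have := le _ hN; rewrite (linN _ (dotp_lin n f)) => l2.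
  by rewrite -/(norm_dual n h f); lra.
by move=> /set0P/negP/negPn/eqP ->; rewrite sup0.
Qed.

(** Together with [norm_dual_le] this makes [norm_dual] the least bound in the sense of [dbound].
    Test functions of zero seminorm are 0, the others are normalised. *)
Lemma dbound_dual n h f : (0 < n)%N -> 0 < h -> dbound n h (dotp n f) (norm_dual n h f).
Proof.
move=> n0 h0; split=> [|v hv]; first exact: norm_dual_ge0.
set S := snorm_one n h 1 v.
have [S0|Sn0] := eqVneq S 0.
  by rewrite S0 mulr0 (Usharp_eq0_one n0 h0 hv S0) (lin0 (dotp_lin n f)).
have S0 : 0 < S by rewrite lt_def Sn0 snorm_one_ge0.
rewrite -ler_pdivrMr// mulrC -(linZ _ _ (dotp_lin n f)).
apply: ub_le_sup; first exact: dual_ub.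
exists (S^-1 *: v) => //; split; first exact: UsharpZ.
by rewrite snorm_oneZ gtr0_norm ?invr_gt0// mulVf.
Qed.

Lemma norm_dual_le n h f M : dbound n h (dotp n f) M -> norm_dual n h f <= M.
Proof.
move=> [M0 fM]; rewrite /norm_dual.
have [[x Sx]|] := pselect ([set dotp n f v | v in sphere_one n h] !=set0).
  apply: ge_sup; first by exists x.
  by move=> _ [v [hv v1] <-]; have := fM v hv; rewrite v1 mulr1.
by move=> /set0P/negP/negPn/eqP ->; rewrite sup0.
Qed.

Lemma norm_dualD n h f g : (0 < n)%N -> 0 < h ->
  norm_dual n h (f + g) <= norm_dual n h f + norm_dual n h g.
Proof.
move=> n0 h0; apply: norm_dual_le.
apply: eq_dbound (dboundD (dbound_dual f n0 h0) (dbound_dual g n0 h0)) => v _.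
by rewrite dotpDl.
Qed.

End core.

(** * Square linear problems on mean-zero periodic functions *)

Section linear_solve.
Context {R : realType}.
Implicit Types (u v w : int -> R) (k : int).

Let idx m k : nat := `|(k %% m.+1%:Z)%Z|%N.

Let idxK m k : ((k %% m.+1%:Z)%Z = idx m k) * (idx m k < m.+1)%N.
Proof.
have h0 : 0 <= (k %% m.+1%:Z)%Z by apply: modz_ge0; lia.
have h1 : (k %% m.+1%:Z)%Z < m.+1%:Z by apply: ltz_pmod; lia.
by rewrite /idx; move: h0 h1; case: (_ %% _)%Z => // a _; split=> //; lia.
Qed.

(** Basis of the mean-zero functions of period m + 1: indicator of the residue j minus that of the
    residue m. The coordinates of v are its values at 0..m-1; the value at m is then forced by the
    zero mean. *)
Let e m (j : 'I_m) : int -> R := fun k => (idx m k == j)%:R - (idx m k == m)%:R.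

Let periodic_idx m u k : periodic u m.+1%:Z -> u k = u (idx m k)%:Z.
Proof.
move=> hu; rewrite -(idxK m k).1 -[LHS](periodic_mulz _ (- (k %/ m.+1%:Z)%Z) hu).
by congr u; have := divz_eq k m.+1%:Z; lia.
Qed.

Let idxD m k : idx m (k + m.+1%:Z) = idx m k.
Proof. by rewrite /idx modzDr. Qed.

Let idx_small m (j : nat) : (j < m.+1)%N -> idx m j%:Z = j.
Proof. by move=> jm; rewrite /idx modz_small//; lia. Qed.

Let sum_period m v : Usharp m.+1 v -> \sum_(i < m) v i%:Z = - v m%:Z.
Proof.
move=> [hv mv]; have := mean_shift (-1) hv; rewrite mv /mean => /eqP.
rewrite mulf_eq0 invr_eq0 pnatr_eq0 /= big_add1 /= => /eqP.
rewrite (eq_bigr (fun i : nat => v i%:Z)); last by move=> i _; congr v; lia.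
by rewrite big_mkord big_ord_recr /= => /eqP; rewrite addr_eq0 => /eqP.
Qed.

(** The match on the reflection view supplies the proof of idx m k < m from which the ordinal is
    built. *)
Let combE m (x : 'I_m -> R) k :
  (\sum_(j < m) x j *: e j) k =
  (if (idx m k < m)%N =P true is ReflectT p then x (Ordinal p)
   else - \sum_(j < m) x j).
Proof.
rewrite fct_sumE (eq_bigr (fun j : 'I_m =>
  x j * ((idx m k == j)%:R - (idx m k == m)%:R))) //.
case: eqP => [p|p].
  rewrite (bigD1 (Ordinal p))//= big1 => [|j jn].
    by rewrite eqxx (ltn_eqF p) addr0 subr0 mulr1.
  rewrite (ltn_eqF p) subr0 (_ : (_ == _) = false) ?mulr0//.
  by apply/negbTE; apply: contraNneq jn => E; apply/eqP/val_inj.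
have im : idx m k = m by have := (idxK m k).2; move/negP : p; lia.
rewrite -sumrN; apply: eq_bigr => j _.
by rewrite im eqxx (gtn_eqF (ltn_ord j)) sub0r mulrN1.
Qed.

Let e_Usharp m (j : 'I_m) : Usharp m.+1 (e j).
Proof.
split=> [k|]; first by rewrite /e idxD.
rewrite /e meanB; have pI i : periodic (fun k => (idx m k == i)%:R : R) m.+1%:Z.
  by move=> k; rewrite idxD.
suff H i : (i < m.+1)%N -> mean m.+1 (fun k => (idx m k == i)%:R : R) = m.+1%:R^-1.
  by rewrite !H ?subrr// ltnW// ltnS ltn_ord.
move=> im; rewrite -(mean_shift (-1) (pI i)) /mean big_add1 /=.
rewrite (eq_big_nat _ _ (F2 := fun l : nat => (l == i)%:R)); last first.
  by move=> l /andP[_ lm]; rewrite (_ : _ + _ = l%:Z) ?idx_small//; lia.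
rewrite big_mkord (bigD1 (Ordinal im))//= eqxx big1 ?addr0 ?mulr1// => l ln.
by rewrite (_ : _ == _ = false)//; apply/negbTE; apply: contraNneq ln => E; apply/eqP/val_inj.
Qed.

Let Usharp_comb m v : Usharp m.+1 v -> v = \sum_(j < m) v j%:Z *: e j.
Proof.
move=> hv; apply/funext => k; rewrite combE (periodic_idx k (proj1 hv)).
case: eqP => // p; rewrite sum_period// opprK; congr v; congr Posz.
by have := (idxK m k).2; move/negP : p; lia.
Qed.

Let comb_Usharp m (x : 'I_m -> R) : Usharp m.+1 (\sum_(j < m) x j *: e j).
Proof.
apply: (big_ind (Usharp m.+1)); [exact: Usharp0|exact: UsharpD|].
by move=> j _; apply/UsharpZ/e_Usharp.
Qed.

(** In the basis [e] the problem is a square matrix equation. A row in the kernel of the matrix is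
    the coordinate vector of some w with B w = 0, hence zero, so the matrix is invertible. *)
Lemma linear_solve n (B : (int -> R) -> (int -> R) -> R) (l : (int -> R) -> R) :
  (0 < n)%N -> (forall w, lin (B w)) -> (forall v, lin (B^~ v)) -> lin l ->
  (forall w, Usharp n w -> (forall v, Usharp n v -> B w v = 0) -> w = 0) ->
  exists2 w, Usharp n w & forall v, Usharp n v -> B w v = l v.
Proof.
case: n => // m _ Blr Bll ll inj.
pose M := \matrix_(i < m, j < m) B (e i) (e j).
have BM (x : 'rV[R]_m) j : B (\sum_(i < m) x 0 i *: e i) (e j) = (x *m M) 0 j.
  by rewrite (lin_sum _ _ (Bll _)) mxE; apply: eq_bigr => i _; rewrite mxE.
have uM : M \in unitmx.
  rewrite -row_free_unit -kermx_eq0; apply/eqP/row_matrixP => i; rewrite row0.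
  set x := row i _; have xM : x *m M = 0 by rewrite -row_mul mulmx_ker row0.
  have x0 : \sum_(j < m) x 0 j *: e j = 0.
    apply: inj => [|v hv]; first exact: comb_Usharp.
    rewrite (Usharp_comb hv) (lin_sum _ _ (Blr _)) big1// => j _.
    by rewrite BM xM mxE mulr0.
  apply/rowP => j; rewrite [RHS]mxE.
  have := combE (x 0) j%:Z; rewrite x0 idx_small; last exact: ltnW (ltn_ord j).
  case: eqP => [p H|]; last by rewrite ltn_ord.
  rewrite [RHS](_ : _ = (0 : int -> R) j%:Z)// H; congr (x _ _); exact/val_inj.
pose x := (\row_j l (e j)) *m invmx M.
exists (\sum_(i < m) x 0 i *: e i) => [|v hv]; first exact: comb_Usharp.
rewrite (Usharp_comb hv) (lin_sum _ _ (Blr _)) (lin_sum _ _ ll).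
by apply: eq_bigr => j _; rewrite BM mulmxKV// mxE.
Qed.

End linear_solve.

(** * Newton's method with frozen Hessian *)

Section geometric.
Context {R : realType}.

(** Limits of Newton iterates are handled through explicit errors C / 2^j. If y < x, some 2^j
    exceeds C / (x - y). *)
Lemma le_geometric (x y C : R) : (forall j : nat, x <= y + C / 2 ^+ j) -> x <= y.
Proof.
move=> H; rewrite leNgt; apply/negP => yx.
have C0 : 0 < C by have := H 0%N; rewrite expr0 divr1; lra.
have [j Hj] : exists j : nat, C / (x - y) < 2 ^+ j.
  exists (Num.bound (C / (x - y))); apply: (lt_le_trans (archi_boundP _)).
    by rewrite divr_ge0// ltW// subr_gt0.
  by rewrite -natrX ler_nat ltnW// ltn_expl.
have := H j; rewrite -lerBlDl ler_pdivlMr ?exprn_gt0//.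
by rewrite ltr_pdivrMr ?subr_gt0// in Hj; lra.
Qed.

Lemma eq0_geometric (x C : R) : (forall j : nat, `|x| <= C / 2 ^+ j) -> x = 0.
Proof.
move=> H; apply/normr0_eq0/eqP; rewrite eq_le normr_ge0 andbT.
by apply: (@le_geometric _ _ C) => j; rewrite add0r.
Qed.

(** Nested intervals: x j - 2C/2^j increases and x j + 2C/2^j decreases; the limit is the supremum
    of the lower ends. *)
Lemma geometric_limit (x : nat -> R) (C : R) :
  (forall j, `|x j.+1 - x j| <= C / 2 ^+ j) ->
  exists l, forall j, `|l - x j| <= 2 * C / 2 ^+ j.
Proof.
move=> H; pose y j := x j - 2 * C / 2 ^+ j; pose z j := x j + 2 * C / 2 ^+ j.
have half (j : nat) : C / 2 ^+ j = 2 * (C / 2 ^+ j.+1).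
  by rewrite exprS; field; rewrite expf_neq0.
have C0 : 0 <= C by have := H 0%N; rewrite expr0 divr1; apply: le_trans.
have q0 j : 0 <= C / 2 ^+ j by rewrite divr_ge0// exprn_ge0.
have yS j : y j <= y j.+1.
  rewrite /y -!mulrA; have := H j; rewrite ler_norml => /andP[]; have := half j; lra.
have zS j : z j.+1 <= z j.
  rewrite /z -!mulrA; have := H j; rewrite ler_norml => /andP[]; have := half j; lra.
have ym i j : (i <= j)%N -> y i <= y j by apply: (@homo_leq _ _ (<=%O)) => //; exact: le_trans.
have zm i j : (i <= j)%N -> z j <= z i.
  by apply: (@homo_leq _ _ (fun a b => b <= a)) => // a b c ba ac; exact: le_trans ac ba.
have yz i j : y i <= z j.
  apply: (le_trans (ym i (maxn i j) (leq_maxl _ _))).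
  apply: (le_trans _ (zm j (maxn i j) (leq_maxr _ _))).
  by rewrite /y /z -!mulrA; have := q0 (maxn i j); lra.
exists (sup (range y)) => j; rewrite ler_norml.
have hub : has_ubound (range y) by exists (z 0%N) => _ [i _ <-].
have h1 : y j <= sup (range y) by apply: ub_le_sup => //; exists j.
have h2 : sup (range y) <= z j.
  by apply: ge_sup; [exists (y 0%N), 0%N | move=> _ [i _ <-]].
by move: h1 h2; rewrite /y /z => h1 h2; apply/andP; split; lra.
Qed.

End geometric.

Section nonlinear.
Context {R : realType}.
Implicit Types (u v w f g : int -> R) (h c M x y z K rho L : R) (k : int).
Implicit Types (s t : nat -> int -> R) (a b : nat -> int -> R -> R).

Definition inball m s0 rho s :=
  forall r k, (1 <= r <= m)%N -> `|s r k - s0 r k| < rho.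

(** [b] plays the derivative of the force [a]: C^{1,1} regularity expressed by a Taylor remainder
    and a Lipschitz bound. K is qualitative; it enters no final constant and serves only the passage
    to the limit in the Newton iteration. *)
Definition regular m a b s0 rho L :=
  [/\ 0 < rho, 0 <= L,
    (forall r k x y, (1 <= r <= m)%N ->
       `|x - s0 r k| < rho -> `|y - s0 r k| < rho ->
       `|a r k x - a r k y - b r k y * (x - y)| <= L * `|x - y| ^+ 2 /\
       `|b r k x - b r k y| <= L * `|x - y|) &
    exists K, forall r k, (1 <= r <= m)%N -> `|b r k (s0 r k)| <= K].

Lemma regular_weak m a b s0 rho rho' L : 0 < rho' <= rho ->
  regular m a b s0 rho L -> regular m a b s0 rho' L.
Proof.
move=> /andP[r0 rr] [_ L0 H K]; split=> // r k x y hr hx hy.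
by apply: H => //; exact: lt_le_trans rr.
Qed.

(** Moving the derivative from y to the centre costs L rho, and the quadratic remainder costs 2 L
    rho since |x - y| <= 2 rho: this is the 3 of the smallness condition on rho. *)
Lemma regular_strong m a b s0 rho L r k x y : regular m a b s0 rho L ->
  (1 <= r <= m)%N -> `|x - s0 r k| < rho -> `|y - s0 r k| < rho ->
  `|a r k x - a r k y - b r k (s0 r k) * (x - y)| <= 3 * L * rho * `|x - y|.
Proof.
move=> [r0 L0 H _] hr hx hy; have [H1 _] := H r k x y hr hx hy.
have h00 : `|s0 r k - s0 r k| < rho by rewrite subrr normr0.
have [_ H2] := H r k y (s0 r k) hr hy h00.
have -> : a r k x - a r k y - b r k (s0 r k) * (x - y) =
  (a r k x - a r k y - b r k y * (x - y)) + (b r k y - b r k (s0 r k)) * (x - y).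
  by ring.
apply: (le_trans (ler_normD _ _)); rewrite normrM.
have d2 : `|x - y| <= 2 * rho.
  have -> : x - y = (x - s0 r k) - (y - s0 r k) by ring.
  by apply: (le_trans (ler_normB _ _)); lra.
set d := `|x - y| in d2 H1 *; have d0 : 0 <= d by exact: normr_ge0.
have e1 : L * d ^+ 2 <= 2 * L * rho * d.
  have -> : 2 * L * rho * d = L * (2 * rho * d) by ring.
  by rewrite ler_wpM2l// expr2 ler_wpM2r.
have e2 : `|b r k y - b r k (s0 r k)| * d <= L * rho * d.
  by rewrite ler_wpM2r//; apply: (le_trans H2); rewrite ler_wpM2l// ltW.
lra.
Qed.

(** The offset z is the macroscopic strain of the cell problem; the lattice problems take z = 0. *)
Definition strain h z u : nat -> int -> R := fun r k => z + Diff h r u k.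

Variables (n m : nat) (h : R) (a b : nat -> int -> R -> R) (s0 : nat -> int -> R).
Variables (rho L c : R).
Hypotheses (n0 : (0 < n)%N) (h0 : 0 < h) (c0 : 0 < c).
Hypothesis reg : regular m a b s0 rho L.
Hypothesis stab : stable n h m (fun r k => b r k (s0 r k)) (2 * c).
Hypothesis small : 3 * m%:R * L * rho <= c.

Let rho0 : 0 < rho. Proof. by case: reg. Qed.
Let L0 : 0 <= L. Proof. by case: reg. Qed.

(** Replacing the stiffness at s by that at s0 changes the functional by at most m L rho |w|, a
    third of c |w|, which the surplus in 2c absorbs. *)
Lemma linear_stability s w M : inball m s0 rho s -> Usharp n w ->
  dbound n h (core n h m (fun r k => b r k (s r k) * Diff h r w k)) M ->
  c * snorm_inf n h 1 w <= M.
Proof.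
move=> sb hw hM; set X := snorm_inf n h 1 w.
have X0 : 0 <= X by exact: snorm_inf_ge0.
suff : 2 * c * X <= M + m%:R * (L * rho * X).
  have : 3 * (m%:R * L * rho) * X <= c * X by rewrite ler_wpM2r// !mulrA.
  have : 0 <= m%:R * L * rho * X by rewrite !mulr_ge0// ltW.
  lra.
apply: (stab hw); apply: eq_dbound (dboundD hM (dbound_core (s := fun r k =>
   (b r k (s0 r k) - b r k (s r k)) * Diff h r w k) n h _ _)) => [v _||r k hr].
- by rewrite -coreD; apply: eq_core => r k _; ring.
- by rewrite !mulr_ge0// ltW.
- rewrite normrM; apply: ler_pM => //; last first.
    by apply: Diff_le => //; [case: hw|case/andP: hr].
  case: reg => _ _ H _; have h00 : `|s0 r k - s0 r k| < rho by rewrite subrr normr0.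
  have [_ H2] := H r k _ _ hr h00 (sb r k hr).
  by apply: (le_trans H2); rewrite ler_wpM2l// distrC ltW// sb.
Qed.

Lemma linear_unique s w w' : inball m s0 rho s -> Usharp n w -> Usharp n w' ->
  (forall v, Usharp n v -> core n h m (fun r k => b r k (s r k) * Diff h r w k) v =
                         core n h m (fun r k => b r k (s r k) * Diff h r w' k) v) ->
  w = w'.
Proof.
move=> sb hw hw' E; apply/eqP; rewrite -subr_eq0; apply/eqP.
have hd := UsharpB hw hw'.
apply: (Usharp_eq0 n0 h0 hd); rewrite -(ler_pM2l c0) mulr0.
apply: (linear_stability sb hd); split=> // v hv; rewrite mul0r.
by rewrite (linB _ _ (core_Diff_linl _ _ _ (fun r k => b r k (s r k)) v)) E// subrr.
Qed.

Lemma linear_solution s l : inball m s0 rho s -> lin l ->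
  exists2 w, Usharp n w & forall v, Usharp n v ->
    core n h m (fun r k => b r k (s r k) * Diff h r w k) v = l v.
Proof.
move=> sb ll; apply: linear_solve => // [w|v|w hw H].
- exact: core_lin.
- exact: (core_Diff_linl _ _ _ (fun r k => b r k (s r k))).
- apply: (linear_unique sb hw (Usharp0 n)) => v hv; rewrite H//.
  by rewrite (lin0 (core_Diff_linl _ _ _ (fun r k => b r k (s r k)) v)).
Qed.

(** Linearising at s0 costs 3 m L rho <= c, leaving c out of 2c. Only the difference s - t has to be
    a discrete gradient, so both fields may carry the same offset z. *)
Lemma nonlinear_stability s t w M : inball m s0 rho s -> inball m s0 rho t ->
  Usharp n w -> (forall r k, (1 <= r <= m)%N -> s r k - t r k = Diff h r w k) ->
  dbound n h (core n h m (fun r k => a r k (s r k) - a r k (t r k))) M ->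
  c * snorm_inf n h 1 w <= M.
Proof.
move=> sb tb hw e hM; set X := snorm_inf n h 1 w.
have X0 : 0 <= X by exact: snorm_inf_ge0.
suff : 2 * c * X <= M + m%:R * (3 * L * rho * X).
  have : 3 * m%:R * L * rho * X <= c * X by rewrite ler_wpM2r.
  lra.
apply: (stab hw); apply: eq_dbound (dboundD hM (dbound_core (s := fun r k =>
   b r k (s0 r k) * (s r k - t r k) - (a r k (s r k) - a r k (t r k))) n h _ _)) => [v _||r k hr].
- by rewrite -coreD; apply: eq_core => r k hr; rewrite e//; ring.
- by rewrite !mulr_ge0// ltW.
- rewrite distrC; apply: (le_trans (regular_strong reg hr (sb _ _ hr) (tb _ _ hr))).
  rewrite ler_wpM2l ?mulr_ge0// ?(ltW rho0)// e//.
  by apply: Diff_le => //; [case: hw|case/andP: hr].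
Qed.

Let S z u := core n h m (fun r k => a r k (strain h z u r k)).

Lemma nonlinear_solution z u0 l rho' M : Usharp n u0 -> lin l ->
  (forall u, Usharp n u -> snorm_inf n h 1 (u - u0) < rho' ->
     inball m s0 rho (strain h z u)) ->
  dbound n h (fun v => l v - S z u0 v) M -> M < c * rho' ->
  exists u, [/\ Usharp n u, snorm_inf n h 1 (u - u0) <= M / c &
    forall v, Usharp n v -> S z u v = l v].
Proof.
move=> hu0 ll sb hM Mc; pose X := snorm_inf n h 1.
have M0 : 0 <= M by case: hM.
have Mr : M / c < rho' by rewrite ltr_pdivrMr// mulrC.
have Mc0 : 0 <= M / c by rewrite divr_ge0// ltW.
pose H w := core n h m (fun r k => b r k (s0 r k) * Diff h r w k).
have s0b : inball m s0 rho s0 by move=> r k _; rewrite subrr normr0.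
have /choice[G hG] : forall u, exists w, Usharp n w /\
    forall v, Usharp n v -> H w v = l v - S z u v.
  move=> u.
  have [|w hw1 hw2] := @linear_solution s0 (fun v => l v - S z u v) s0b; last by exists w.
  by move=> c' v w; rewrite ll /S core_lin; ring.
have hGU u : Usharp n (G u) by case: (hG u).
have strainB u u' r k : strain h z u r k - strain h z u' r k = Diff h r (u - u') k.
  by rewrite DiffB !fctE /strain; ring.
have err u u' : Usharp n u -> Usharp n u' -> inball m s0 rho (strain h z u) ->
    inball m s0 rho (strain h z u') ->
    dbound n h (fun v => H (u - u') v - (S z u v - S z u' v))
      (c * X (u - u')).
  move=> hu hu' ub ub'; have hd := UsharpB hu hu'.
  apply: (@dbound_weak _ _ _ _ (m%:R * (3 * L * rho * X (u - u')))).
    rewrite [leLHS](_ : _ = 3 * m%:R * L * rho * X (u - u')); last by ring.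
    by rewrite ler_wpM2r// snorm_inf_ge0.
  apply: eq_dbound (dbound_core (s := fun r k => b r k (s0 r k) * Diff h r (u - u') k
    - (a r k (strain h z u r k) - a r k (strain h z u' r k))) n h _ _) => [v _||r k hr].
  - by rewrite !coreB.
  - by rewrite !mulr_ge0// ?(ltW rho0)// snorm_inf_ge0.
  - rewrite -strainB distrC.
    apply: (le_trans (regular_strong reg hr (ub _ _ hr) (ub' _ _ hr))).
    rewrite ler_wpM2l ?mulr_ge0// ?(ltW rho0)// strainB.
    by apply: Diff_le => //; [case: hd|case/andP: hr].
pose U j := iter j (fun u => u + G u) u0.
have UU j : Usharp n (U j) by elim: j => //= j ih; exact: UsharpD.
have dU j : U j.+1 - U j = G (U j) by rewrite /U /= addrC addrA addNr add0r.
have pow (j : nat) : (2 : R) ^+ j != 0 by rewrite expf_neq0.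
(* The first increment is at most M / (2c) by stability. The second bound keeps the iterates in the
   ball where [err] applies, so the two are proved together. *)
have main j : X (G (U j)) <= M / c / 2 / 2 ^+ j /\
              X (U j - u0) <= M / c * (1 - 1 / 2 ^+ j).
  elim: j => [|j [ih1 ih2]].
    rewrite expr0 !divr1 !subrr mulr0 [X 0]snorm_inf0; split=> //.
    have : 2 * c * X (G u0) <= M.
      by apply: (stab (hGU _)); apply: eq_dbound hM => v hv; rewrite -(hG u0).2.
    by rewrite ler_pdivlMr// ler_pdivlMr//; lra.
  have jp : 0 < 1 / (2 : R) ^+ j by rewrite divr_gt0// exprn_gt0.
  have e2 : 1 / (2 : R) ^+ j = 2 * (1 / 2 ^+ j.+1) by rewrite exprS; field; rewrite pow.
  have lt1 x : 0 < x -> M / c * (1 - x) < rho'.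
    by move=> x0; apply: le_lt_trans Mr; rewrite ler_piMr//; lra.
  have hj1 : X (U j.+1 - u0) <= M / c * (1 - 1 / 2 ^+ j.+1).
    have -> : U j.+1 - u0 = (U j - u0) + G (U j) by rewrite /U /=; exact: addrAC.
    apply: (le_trans (snorm_infD _ n0 (proj1 (UsharpB (UU j) hu0)) (proj1 (hGU _)))).
    apply: (le_trans (lerD ih2 ih1)); rewrite e2.
    rewrite [X in _ + X](_ : _ = M / c * (1 / 2 ^+ j.+1)).
      by rewrite -mulrDr; apply: ler_wpM2l => //; lra.
    by rewrite exprS; field; rewrite pow gt_eqF.
  split=> //; have bj : inball m s0 rho (strain h z (U j)).
    by apply: sb => //; apply: (le_lt_trans ih2); apply: lt1.
  have bj1 : inball m s0 rho (strain h z (U j.+1)).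
    by apply: sb => //; apply: (le_lt_trans hj1); apply: lt1; rewrite divr_gt0// exprn_gt0.
  have := err _ _ (UU j.+1) (UU j) bj1 bj; rewrite dU => E.
  have : 2 * c * X (G (U j.+1)) <= c * X (G (U j)).
    apply: (stab (hGU _)); apply: eq_dbound E => v hv.
    by rewrite -/(H _ _) !(hG _).2//; ring.
  rewrite -mulrA mulrCA ler_pM2l// => E2.
  have e3 : M / c / 2 / 2 ^+ j = 2 * (M / c / 2 / 2 ^+ j.+1).
    by rewrite exprS; field; rewrite pow gt_eqF.
  lra.
have lim k : exists l, forall j, `|l - U j k| <= 2 * (n%:R * h * (M / c)) / 2 ^+ j.
  apply: geometric_limit => j; have [H1 _] := main j.
  rewrite [X in `|X|](_ : _ = G (U j) k); last by rewrite -dU !fctE.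
  have := Usharp_sup_le k n0 h0 (hGU (U j)); rewrite -/(X _) => H2.
  have H3 : n%:R * h * X (G (U j)) <= n%:R * h * (M / c / 2 / 2 ^+ j).
    by rewrite ler_wpM2l// mulr_ge0// ltW.
  have : n%:R * h * (M / c / 2 / 2 ^+ j) = n%:R * h * (M / c) / 2 ^+ j / 2.
    by field; rewrite pow gt_eqF.
  have : 0 <= n%:R * h * (M / c) / 2 ^+ j by rewrite divr_ge0 ?exprn_ge0// mulr_ge0// mulr_ge0// ltW.
  lra.
have [u hu] := choice lim; set C := 2 * _ in hu.
have C0 : 0 <= C by rewrite mulr_ge0// mulr_ge0// mulr_ge0// ltW.
have uU : Usharp n u.
  split=> [k|].
    apply/eqP; rewrite -subr_eq0; apply/eqP; apply: (@eq0_geometric _ _ (C + C)) => j.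
    have -> : u (k + n%:Z) - u k = (u (k + n%:Z) - U j (k + n%:Z)) - (u k - U j k).
      by rewrite (proj1 (UU j)); ring.
    by apply: (le_trans (ler_normB _ _)); rewrite mulrDl lerD// hu.
  apply: (@eq0_geometric _ _ C) => j.
  have -> : mean n u = mean n (fun k => u k - U j k) by rewrite meanB (proj2 (UU j)) subr0.
  apply: (le_trans (mean_norm _ _)); rewrite -[leRHS](mean_cst _ n0).
  by apply: mean_le => k; rewrite hu.
(* The pointwise error is divided by the lattice spacing. The constant depends on h, but only the
   decay in j matters here. *)
have XU j : X (u - U j) <= (C + C) / h / 2 ^+ j.
  apply: norm_inf_le => [|k].
    rewrite divr_ge0 ?exprn_ge0// divr_ge0 ?(ltW h0)//.
    exact: addr_ge0.
  rewrite /= Diff1E !fctE normrM normfV (gtr0_norm h0).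
  rewrite [leRHS](_ : _ = (C + C) / 2 ^+ j / h); last by rewrite mulrAC.
  rewrite ler_wpM2r ?invr_ge0 ?(ltW h0)//.
  by apply: (le_trans (ler_normB _ _)); rewrite mulrDl lerD// hu.
have Xu : X (u - u0) <= M / c.
  apply: (@le_geometric _ _ _ ((C + C) / h)) => j.
  have -> : u - u0 = (U j - u0) + (u - U j) by apply/funext => k; rewrite !fctE; ring.
  apply: (le_trans (snorm_infD _ n0 (proj1 (UsharpB (UU j) hu0)) (proj1 (UsharpB uU (UU j))))).
  apply: lerD; last exact: XU.
  by apply: (le_trans (main j).2); rewrite ler_piMr// gerBl divr_ge0// exprn_ge0.
have ub : inball m s0 rho (strain h z u) by apply: sb => //; exact: le_lt_trans Mr.
exists u; split=> // v hv.
have [K0 HK0] : exists K, forall r k, (1 <= r <= m)%N -> `|b r k (s0 r k)| <= K by case: reg.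
pose K := Num.max K0 0; have K_ge0 : 0 <= K by rewrite le_max lexx orbT.
have HK r k : (1 <= r <= m)%N -> `|b r k (s0 r k)| <= K.
  by move=> hr; rewrite le_max HK0.
have HH w : Usharp n w -> `|H w v| <= m%:R * K * X w * snorm_one n h 1 v.
  move=> hw; rewrite -(mulrA _ K); apply: core_le; [|by case: hv|].
    by rewrite mulr_ge0// snorm_inf_ge0.
  move=> r k hr; rewrite normrM ler_pM// ?HK//.
  by apply: Diff_le => //; [case: hw|case/andP: hr].
set V := snorm_one n h 1 v in HH; have V0 : 0 <= V by exact: snorm_one_ge0.
apply/eqP; rewrite -subr_eq0; apply/eqP.
(* The residual at the limit splits into H applied to the error u - U j, a linearisation error, and
   H applied to the last increment; each is O(2^-j), hence the residual is 0. *)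
pose D := (C + C) / h; pose E := M / c / 2.
apply: (@eq0_geometric _ _ (m%:R * K * D * V + c * D * V + m%:R * K * E * V)) => j.
have bj : inball m s0 rho (strain h z (U j)).
  apply: sb => //; apply: (le_lt_trans (main j).2); apply: le_lt_trans Mr.
  by rewrite ler_piMr// gerBl divr_ge0// exprn_ge0.
have hd := UsharpB uU (UU j).
have e1 : `|H (u - U j) v| <= m%:R * K * D * V / 2 ^+ j.
  apply: (le_trans (HH _ hd)); rewrite -/X.
  rewrite [leRHS](_ : _ = m%:R * K * (D / 2 ^+ j) * V); last by ring.
  by rewrite ler_wpM2r// ler_wpM2l ?mulr_ge0// XU.
have e2 : `|H (u - U j) v - (S z u v - S z (U j) v)| <= c * D * V / 2 ^+ j.
  have lle : lin (fun v => H (u - U j) v - (S z u v - S z (U j) v)).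
    by move=> c' v1 v2; rewrite /H /S !core_lin; ring.
  have E1 := err _ _ uU (UU j) ub bj; have E2 := dbound_opp lle E1.
  have F : c * X (u - U j) * V <= c * D * V / 2 ^+ j.
    rewrite [leRHS](_ : _ = c * (D / 2 ^+ j) * V); last by ring.
    by rewrite ler_wpM2r// ler_wpM2l ?XU// ltW.
  rewrite ler_norml; apply/andP; split.
    by rewrite lerNl; apply: le_trans F; exact: (E2.2 v hv).
  by apply: le_trans F; exact: (E1.2 v hv).
have e3 : `|H (G (U j)) v| <= m%:R * K * E * V / 2 ^+ j.
  apply: (le_trans (HH _ (hGU _))).
  rewrite [leRHS](_ : _ = m%:R * K * (E / 2 ^+ j) * V); last by ring.
  by rewrite ler_wpM2r// ler_wpM2l ?mulr_ge0//; case: (main j).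
have -> : S z u v - l v = H (u - U j) v - (H (u - U j) v - (S z u v - S z (U j) v))
   - H (G (U j)) v by rewrite (hG _).2//; ring.
rewrite !mulrDl; apply: (le_trans (ler_normB _ _)); apply: lerD => //.
by apply: (le_trans (ler_normB _ _)); apply: lerD.
Qed.

End nonlinear.

(** * The solution map *)

Section solution_map.
Context {R : realType}.
Variables (n m : nat) (a b : nat -> int -> R -> R) (us : int -> R).
Variables (rho L c : R).
Let h : R := eps n.
Let s0 : nat -> int -> R := fun r => Diff h r us.
Hypotheses (n0 : (0 < n)%N) (c0 : 0 < c).
Hypothesis reg : regular m a b s0 rho L.
Hypothesis stab : stable n h m (fun r k => b r k (s0 r k)) (2 * c).
Hypothesis small : 3 * m%:R * L * rho <= c.
Hypothesis hus : Usharp n us.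
Hypothesis eq0 : forall v, Usharp n v -> core n h m (fun r k => a r k (s0 r k)) v = 0.
Variable rhof : R.
Hypothesis rhofc : rhof <= c * rho.

Let h0 : 0 < h. Proof. by rewrite invr_gt0 ltr0n. Qed.
Let L0 : 0 <= L. Proof. by case: reg. Qed.

Definition equilibrium (f u : int -> R) := forall v, Usharp n v ->
  core n h m (fun r k => a r k (Diff h r u k)) v = dotp n f v.

Let Bu := [set u : int -> R | Usharp n u /\ snorm_inf n h 1 (u - us) < rho].
Let Bf := ball_f n rhof.

Let Bu_inball u : Bu u -> inball m s0 rho (fun r => Diff h r u).
Proof.
move=> [hu ur] r k /andP[r1 _]; apply: le_lt_trans ur.
rewrite [X in `|X|](_ : _ = Diff h r (u - us) k); last by rewrite DiffB.
by apply: Diff_le => //; case: (UsharpB hu hus).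
Qed.

(** With f = g this is uniqueness; with g = 0 and w = us it measures the distance to the reference
    state. *)
Lemma equilibrium_lipschitz f g u w : Bu u -> Bu w ->
  equilibrium f u -> equilibrium g w ->
  c * snorm_inf n h 1 (u - w) <= norm_dual n h (f - g).
Proof.
move=> bu bw su sw; have [hu _] := bu; have [hw _] := bw.
apply: (nonlinear_stability n0 reg stab small (Bu_inball bu) (Bu_inball bw) (UsharpB hu hw)).
  by move=> r k _; rewrite DiffB.
apply: eq_dbound (dbound_dual (f - g) n0 h0) => v hv.
by rewrite coreB su// sw// dotpBl.
Qed.

Let equilibrium_us : equilibrium 0 us.
Proof. by move=> v hv; rewrite eq0// dotpC (lin0 (dotp_lin n v)). Qed.

Let Bu_us : Bu us.
Proof. by split=> //; rewrite subrr snorm_inf0; case: reg. Qed.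

Lemma equilibrium_center f u : Bu u -> equilibrium f u ->
  c * snorm_inf n h 1 (u - us) <= norm_dual n h f.
Proof. by move=> bu su; rewrite -[f]subr0; exact: equilibrium_lipschitz. Qed.

Let equilibrium_exists f : Bf f -> exists u, Bu u /\ equilibrium f u.
Proof.
move=> [hf fr]; have Mr : norm_dual n h f < c * rho by exact: lt_le_trans rhofc.
have seq u : (fun r => Diff h r u) = strain h 0 u.
  by apply/funext => r; apply/funext => k; rewrite /strain add0r.
have [||u [hu Xu su]] := @nonlinear_solution _ n m h a b s0 rho L c n0 h0 c0
    reg stab small 0 us (dotp n f) rho (norm_dual n h f) hus (dotp_lin n f) _ _ Mr.
- by move=> u hu ur; rewrite -seq; exact: Bu_inball.
- apply: eq_dbound (dbound_dual f n0 h0) => v hv.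
  by rewrite -seq eq0// subr0.
- exists u; split; last by move=> v hv; rewrite -su// -seq.
  by split=> //; apply: (le_lt_trans Xu); rewrite ltr_pdivrMr// mulrC.
Qed.

Let H u w := core n h m (fun r k => b r k (Diff h r u k) * Diff h r w k).

Let H_lin u v : lin (fun w => H u w v).
Proof. exact: (core_Diff_linl _ _ _ (fun r k => b r k (Diff h r u k))). Qed.

Let H_unique u w w' : Bu u -> Usharp n w -> Usharp n w' ->
  (forall v, Usharp n v -> H u w v = H u w' v) -> w = w'.
Proof. by move=> bu; exact: (linear_unique n0 h0 c0 reg stab small (Bu_inball bu)). Qed.

Let remainder u u' : Bu u -> Bu u' ->
  dbound n h (fun v => H u (u' - u) v -
    (core n h m (fun r k => a r k (Diff h r u' k)) v
     - core n h m (fun r k => a r k (Diff h r u k)) v))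
    (m%:R * (L * snorm_inf n h 1 (u' - u) ^+ 2)).
Proof.
move=> bu bu'; have [hu _] := bu; have [hu' _] := bu'; have hd := UsharpB hu' hu.
apply: eq_dbound (dbound_core (s := fun r k => b r k (Diff h r u k) * Diff h r (u' - u) k
    - (a r k (Diff h r u' k) - a r k (Diff h r u k))) n h _ _) => [v _||r k hr].
- by rewrite !coreB.
- by rewrite mulr_ge0// exprn_ge0// snorm_inf_ge0.
case: reg => _ _ rg _.
have [H1 _] := rg r k _ _ hr (Bu_inball bu' k hr) (Bu_inball bu k hr).
rewrite distrC DiffB; apply: (le_trans H1); rewrite ler_wpM2l//.
rewrite lerXn2r ?nnegrE ?snorm_inf_ge0//.
rewrite [X in `|X|](_ : _ = Diff h r (u' - u) k); last by rewrite DiffB.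
by apply: Diff_le => //; [case: hd|case/andP: hr].
Qed.

Let H_diff u u' w : Bu u -> Bu u' -> Usharp n w ->
  dbound n h (fun v => H u w v - H u' w v)
    (m%:R * (L * snorm_inf n h 1 (u - u') * snorm_inf n h 1 w)).
Proof.
move=> bu bu' hw; have [hu _] := bu; have [hu' _] := bu'; have hd := UsharpB hu hu'.
apply: eq_dbound (dbound_core (s := fun r k =>
  (b r k (Diff h r u k) - b r k (Diff h r u' k)) * Diff h r w k) n h _ _) => [v _||r k hr].
- by rewrite /H -coreB; apply: eq_core => r k _; ring.
- by rewrite !mulr_ge0// snorm_inf_ge0.
have r1 : (0 < r)%N by case/andP: hr.
rewrite normrM ler_pM//; last by apply: Diff_le => //; case: hw.
case: reg => _ _ rg _.
have [_ H2] := rg r k _ _ hr (Bu_inball bu k hr) (Bu_inball bu' k hr).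
apply: (le_trans H2); rewrite ler_wpM2l//.
rewrite [X in `|X|](_ : _ = Diff h r (u - u') k); last by rewrite DiffB.
by apply: Diff_le => //; case: hd.
Qed.

(** The derivative T f is the inverse of the Hessian at F f, of norm at most 1/c. The resolvent
    identity T f - T g = T f (H(F g) - H(F f)) T g has factors 1/c, m L |f - g| / c and 1/c, whence
    m L / c^3. *)
Lemma solution_map : exists u : (int -> R) -> int -> R,
  unique_solution_map Bf Bu equilibrium u /\
  exists du, [/\ is_C11 n Bf u du, (deriv_normC n Bf du <= (c^-1)%:E)%E &
    (deriv_lip n Bf du <= (m%:R * L / c ^+ 3)%:E)%E].
Proof.
(* Outside [Bf] the value 0 is a filler that makes the map total. *)
have /choice[F hF] : forall f, exists u, Bf f -> Bu u /\ equilibrium f u.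
  move=> f; have [/equilibrium_exists[u hu]|nf] := pselect (Bf f); first by exists u.
  by exists 0.
have /choice[T hT] : forall f, exists T : (int -> R) -> int -> R, Bf f ->
    forall g, Usharp n (T g) /\ forall v, Usharp n v -> H (F f) (T g) v = dotp n g v.
  move=> f; have [hf|nf] := pselect (Bf f); last by exists (fun=> 0).
  have bF := (hF f hf).1.
  have /choice[T hT] : forall g, exists w, Usharp n w /\
      forall v, Usharp n v -> H (F f) w v = dotp n g v.
    move=> g; have [w hw1 hw2] := linear_solution n0 h0 c0 reg stab small
      (Bu_inball bF) (dotp_lin n g).
    by exists w.
  by exists T.
have FU f : Bf f -> Usharp n (F f) by move=> hf; case: (hF f hf) => -[].
have TX f g : Bf f -> c * snorm_inf n h 1 (T f g) <= norm_dual n h g.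
  move=> hf; have [Tu Te] := hT f hf g.
  apply: (linear_stability n0 reg stab small (Bu_inball (hF f hf).1) Tu).
  by apply: eq_dbound (dbound_dual g n0 h0) => v hv; rewrite -Te.
have K0 : 0 <= m%:R * L / c ^+ 3.
  by rewrite divr_ge0 ?exprn_ge0 ?mulr_ge0// ltW.
have Flip f g : Bf f -> Bf g ->
    snorm_inf n h 1 (F f - F g) <= norm_dual n h (f - g) / c.
  move=> hf hg; rewrite ler_pdivlMr// mulrC.
  by apply: equilibrium_lipschitz; [exact: (hF f hf).1|exact: (hF g hg).1|
    exact: (hF f hf).2|exact: (hF g hg).2].
have mL0 : 0 <= m%:R * L by rewrite mulr_ge0.
have dlip : (deriv_lip n Bf T <= (m%:R * L / c ^+ 3)%:E)%E.
  apply: ereal_inf_lbound; exists (m%:R * L / c ^+ 3) => //; split=> // f g hf hg.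
  apply: ge_ereal_sup => _ [x [hx x1] <-]; rewrite lee_fin.
  have [Tf Tfe] := hT f hf x; have [Tg Tge] := hT g hg x.
  have key : c * snorm_inf n h 1 (T f x - T g x) <=
      m%:R * (L * snorm_inf n h 1 (F g - F f) * snorm_inf n h 1 (T g x)).
    apply: (linear_stability n0 reg stab small (Bu_inball (hF f hf).1) (UsharpB Tf Tg)).
    apply: eq_dbound (H_diff (hF g hg).1 (hF f hf).1 Tg) => v hv.
    by rewrite Tge// -Tfe// -(linB _ _ (H_lin (F f) v)).
  rewrite -(ler_pM2l c0); apply: (le_trans key).
  have e1 := Flip f g hf hg; rewrite snorm_infC in e1.
  have e2 : snorm_inf n h 1 (T g x) <= 1 / c.
    by rewrite ler_pdivlMr// mulrC; apply: (le_trans (TX _ _ hg)).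
  rewrite [leRHS](_ : _ = m%:R * L * (norm_dual n h (f - g) / c * (1 / c))); last first.
    by rewrite -/h; field; rewrite gt_eqF.
  rewrite [leLHS](_ : _ = m%:R * L * (snorm_inf n h 1 (F g - F f) * snorm_inf n h 1 (T g x))).
    by rewrite ler_wpM2l// ler_pM// snorm_inf_ge0.
  by ring.
exists F; split.
  move=> f hf; have [bF sF] := hF f hf; split=> // w bw sw.
  apply/eqP; rewrite -subr_eq0; apply/eqP.
  have hd := UsharpB bw.1 (FU f hf).
  apply: (Usharp_eq0 n0 h0 hd); rewrite -(ler_pM2l c0) mulr0.
  apply: (le_trans (equilibrium_lipschitz bw bF sw sF)).
  rewrite subrr; apply: norm_dual_le; split=> // v _.
  by rewrite dotpC (lin0 (dotp_lin n v)) mul0r.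
exists T; split=> //; last first.
  apply: ge_ereal_sup => _ [f hf <-]; apply: ge_ereal_sup => _ [g [hg g1] <-].
  rewrite lee_fin -div1r ler_pdivlMr// mulrC.
  by apply: (le_trans (TX _ _ hf)).
split; last by apply: (le_lt_trans dlip); rewrite ltry.
move=> f hf; have bF := (hF f hf).1; split.
  split=> [g hg|x g g' hg hg']; first by case: (hT f hf g).
  have [T1 E1] := hT f hf g; have [T2 E2] := hT f hf g'; have [T3 E3] := hT f hf (x *: g + g').
  apply: (H_unique bF) => //; first by apply: UsharpD => //; exact: UsharpZ.
  by move=> v hv; rewrite E3// H_lin E1// E2// dotpDl dotpZl.
move=> e e0; have mc0 : 0 < m%:R * L + 1 by rewrite ltr_wpDl.
have fr : 0 < rhof - norm_dual n h f by rewrite subr_gt0; case: hf.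
(* The first entry keeps f + g in [Bf]; the second brings the quadratic remainder below e |g|. The
   added 1 keeps the denominator positive. *)
exists (Num.min (rhof - norm_dual n h f) (e * c ^+ 3 / (m%:R * L + 1))).
  by rewrite lt_min fr divr_gt0// mulr_gt0// exprn_gt0.
move=> g hg; rewrite lt_min => /andP[g1 g2].
have hfg : Bf (f + g).
  split; first by apply: UsharpD => //; case: hf.
  by apply: (le_lt_trans (norm_dualD _ _ n0 h0)); rewrite -ltrBrDl.
have bG := (hF _ hfg).1; have [Tg Te] := hT f hf g.
rewrite -/h; set N := norm_dual n h g in g1 g2 *.
have N0 : 0 <= N by exact: norm_dual_ge0.
have X1 : snorm_inf n h 1 (F (f + g) - F f) <= N / c.
  by have := Flip _ _ hfg hf; rewrite addrAC subrr add0r.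
have key : c * snorm_inf n h 1 (F (f + g) - F f - T f g) <=
    m%:R * (L * snorm_inf n h 1 (F (f + g) - F f) ^+ 2).
  apply: (linear_stability n0 reg stab small (Bu_inball bF)
    (UsharpB (UsharpB (FU _ hfg) (FU _ hf)) Tg)).
  apply: eq_dbound (remainder bF bG) => v hv.
  rewrite (hF _ hfg).2// (hF _ hf).2// dotpDl addrAC subrr add0r -Te//.
  by rewrite -(linB _ _ (H_lin (F f) v)).
rewrite -(ler_pM2l c0); apply: (le_trans key).
apply: (@le_trans _ _ ((m%:R * L + 1) * (N / c) ^+ 2)).
  rewrite mulrA; apply: ler_pM => //; [by rewrite exprn_ge0// snorm_inf_ge0|by rewrite lerDl|].
  by rewrite lerXn2r ?nnegrE ?snorm_inf_ge0// divr_ge0// ltW.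
rewrite ltr_pdivlMr// in g2.
rewrite [leLHS](_ : _ = N * (m%:R * L + 1) * (N / c ^+ 2)); last by field; rewrite gt_eqF.
rewrite [leRHS](_ : _ = e * c ^+ 3 * (N / c ^+ 2)); last by field; rewrite gt_eqF.
by rewrite ler_wpM2r// ?divr_ge0 ?exprn_ge0 ?(ltW c0)// ltW.
Qed.

End solution_map.

(** * Scalar calculus *)

Section scalar.
Context {R : realType}.
Implicit Types (f g a b : R -> R) (x y z s rho k K L d : R) (A : set R).

Lemma lipschitzP A f k : k.-lipschitz_A f <->
  forall x y, A x -> A y -> `|f x - f y| <= k * `|x - y|.
Proof.
split=> [H x y Ax Ay|H [x y] [Ax Ay]]; last exact: H.
by have := H (x, y) (conj Ax Ay).
Qed.

Lemma lip_const_ge0 A f : 0 <= lip_const A f.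
Proof.
rewrite /lip_const.
have [ex|] := pselect ([set k : R | 0 <= k /\ k.-lipschitz_A f] !=set0).
  by apply: lb_le_inf => // k [].
by move=> /set0P/negP/negPn/eqP ->; rewrite inf0.
Qed.

(** The quotient |f x - f y| / |x - y| is a lower bound of the admissible constants; the given k
    shows that there are some. *)
Lemma lip_constP A f k : k.-lipschitz_A f ->
  forall x y, A x -> A y -> `|f x - f y| <= lip_const A f * `|x - y|.
Proof.
move=> /lipschitzP H x y Ax Ay.
have [->|xy] := eqVneq x y; first by rewrite !subrr !normr0 mulr0.
have d0 : 0 < `|x - y| by rewrite normr_gt0 subr_eq0.
rewrite -ler_pdivrMr//; apply: lb_le_inf.
  exists (Num.max k 0); split; first by rewrite le_max lexx orbT.
  apply/lipschitzP => u v Au Av; apply: (le_trans (H _ _ Au Av)).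
  by rewrite ler_wpM2r// le_max lexx.
by move=> l [_ /lipschitzP Hl]; rewrite ler_pdivrMr// Hl.
Qed.

Lemma ball_mean_value_le a b s rho x y : x <= y ->
  (forall t, `|t - s| < rho -> is_derive t 1 a (b t)) ->
  `|x - s| < rho -> `|y - s| < rho ->
  exists c, [/\ `|c - s| < rho, x <= c <= y & a y - a x = b c * (y - x)].
Proof.
move=> xy H hx hy; have inb t : x <= t <= y -> `|t - s| < rho.
  move=> /andP[xt ty]; rewrite ltr_norml in hx; rewrite ltr_norml in hy.
  by rewrite ltr_norml; apply/andP; split; lra.
have [||c cxy e] := @MVT_segment R a b x y xy.
- by move=> t /itvP txy; apply/H/inb; rewrite !txy.
- apply: derivable_within_continuous => t /itvP txy.
  by have [] : is_derive t 1 a (b t) by apply/H/inb; rewrite !txy.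
- by exists c; split=> //; apply/inb; rewrite !(itvP cxy).
Qed.

Lemma ball_mean_value a b s rho x y :
  (forall t, `|t - s| < rho -> is_derive t 1 a (b t)) ->
  `|x - s| < rho -> `|y - s| < rho ->
  exists c, [/\ `|c - s| < rho, `|c - y| <= `|x - y| & a x - a y = b c * (x - y)].
Proof.
move=> H hx hy; have [xy|/ltW yx] := leP x y.
  have [c [cb /andP[c1 c2] e]] := ball_mean_value_le xy H hx hy.
  exists c; split=> //; last by rewrite -opprB e; ring.
  by rewrite distrC (distrC x) !ger0_norm; lra.
have [c [cb /andP[c1 c2] e]] := ball_mean_value_le yx H hy hx.
by exists c; split=> //; rewrite !ger0_norm; lra.
Qed.

Lemma derive_remainder a b s rho L :
  (forall t, `|t - s| < rho -> is_derive t 1 a (b t)) ->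
  (forall x y, `|x - s| < rho -> `|y - s| < rho -> `|b x - b y| <= L * `|x - y|) ->
  0 <= L -> forall x y, `|x - s| < rho -> `|y - s| < rho ->
  `|a x - a y - b y * (x - y)| <= L * `|x - y| ^+ 2.
Proof.
move=> H HL L0 x y hx hy; have [c [cb cy ->]] := ball_mean_value H hx hy.
rewrite -mulrBl normrM expr2 mulrA ler_wpM2r//.
by apply: (le_trans (HL _ _ cb hy)); rewrite ler_wpM2l.
Qed.

Lemma derive_lipschitz a b s rho K :
  (forall t, `|t - s| < rho -> is_derive t 1 a (b t)) ->
  (forall x, `|x - s| < rho -> `|b x| <= K) ->
  forall x y, `|x - s| < rho -> `|y - s| < rho -> `|a x - a y| <= K * `|x - y|.
Proof.
move=> H HK x y hx hy; have [c [cb cy ->]] := ball_mean_value H hx hy.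
by rewrite normrM ler_wpM2r// HK.
Qed.

(** Compare b x with a difference quotient of a: the error is at most L d for step d, and d is
    arbitrarily small. *)
Lemma lipschitz_derive_le a b s rho K L :
  (forall t, `|t - s| < rho -> is_derive t 1 a (b t)) ->
  (forall x y, `|x - s| < rho -> `|y - s| < rho -> `|b x - b y| <= L * `|x - y|) ->
  (forall x y, `|x - s| < rho -> `|y - s| < rho -> `|a x - a y| <= K * `|x - y|) ->
  0 <= L -> forall x, `|x - s| < rho -> `|b x| <= K.
Proof.
move=> H HL HK L0 x hx; apply/ler_addgt0Pl => e e0.
pose r := rho - `|x - s|; have r0 : 0 < r by rewrite subr_gt0.
(* r / 2 keeps x + d in the ball, e / (L + 1) makes the error L d at most e. *)
pose d := Num.min (r / 2) (e / (L + 1)).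
have L1 : 0 < L + 1 by rewrite ltr_wpDl.
have d0 : 0 < d by rewrite lt_min !divr_gt0.
have hy : `|x + d - s| < rho.
  rewrite addrAC; apply: (le_lt_trans (ler_normD _ _)).
  have dr : d <= r / 2 by rewrite /d ge_min lexx.
  by rewrite (gtr0_norm d0); rewrite /r in dr r0; lra.
have := derive_remainder H HL L0 hy hx; have := HK _ _ hy hx.
rewrite (_ : x + d - x = d); last by ring.
rewrite (gtr0_norm d0) => h1 h2.
have h3 : `|b x| * d <= K * d + L * d ^+ 2.
  rewrite -{1}(gtr0_norm d0) -normrM.
  have -> : b x * d = (a (x + d) - a x) - (a (x + d) - a x - b x * d) by ring.
  by apply: (le_trans (ler_normB _ _)); rewrite lerD.
have h4 : `|b x| <= K + L * d.
  by rewrite -(ler_pM2r d0); apply: (le_trans h3); rewrite mulrDl expr2 mulrA.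
apply: (le_trans h4); rewrite addrC lerD2r.
apply: (@le_trans _ _ ((L + 1) * d)); first by rewrite ler_wpM2r ?lerDl// ltW.
by rewrite mulrC -ler_pdivlMr// /d ge_min lexx orbT.
Qed.

(** Meant for the corrector, whose expansion in z comes from stability of the cell problem and not
    from a formula. *)
Lemma remainder_is_derive g z d C r : 0 < r -> 0 <= C ->
  (forall t, `|t - z| < r -> `|g t - g z - d * (t - z)| <= C * `|t - z| ^+ 2) ->
  is_derive z 1 g d.
Proof.
move=> r0 C0 H.
suff E : h^-1 *: (g (h *: 1 + z) - g z) @[h --> 0^'] --> d.
  by apply: DeriveDef; [exact: (cvgP d)|exact: cvg_lim].
apply/cvgrPdist_le => e e0; near=> h.
have hn0 : h != 0 by near: h; exact: nbhs_dnbhs_neq.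
have hr : `|h| < r by near: h; apply: dnbhs0_lt.
have he : `|h| < e / (C + 1) by near: h; apply: dnbhs0_lt; rewrite divr_gt0// ltr_wpDl.
have := H (h + z); rewrite addrK => /(_ hr) Hh.
rewrite [h *: 1]mulr1 -[_ *: _]/(h^-1 * _).
have -> : d - h^-1 * (g (h + z) - g z) = - (h^-1 * (g (h + z) - g z - d * h)).
  by field.
rewrite normrN normrM normfV ler_pdivrMl ?normr_gt0//.
apply: (le_trans Hh); rewrite mulrC expr2 -mulrA ler_wpM2l//.
rewrite mulrC; apply: (@le_trans _ _ ((C + 1) * `|h|)).
  by rewrite ler_wpM2r// lerDl.
by rewrite mulrC -ler_pdivlMr ?ltr_wpDl// ltW.
Unshelve. all: by end_near. Qed.

Lemma is_derive_bigsum (I : eqType) (r : seq I) (F : I -> R -> R) (dF : I -> R) z :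
  (forall i, i \in r -> is_derive z 1 (F i) (dF i)) ->
  is_derive z 1 (fun t => \sum_(i <- r) F i t) (\sum_(i <- r) dF i).
Proof.
elim: r => [|i r ih] H.
  rewrite big_nil (_ : (fun t => _) = cst 0); first exact: is_derive_cst.
  by apply/funext => t; rewrite big_nil.
rewrite big_cons (_ : (fun t => _) = F i + (fun t => \sum_(i <- r) F i t)).
  apply: is_deriveD; first by apply: H; rewrite mem_head.
  by apply: ih => j jr; apply: H; rewrite in_cons jr orbT.
by apply/funext => t; rewrite big_cons.
Qed.

Lemma is_derive_mulrl g z d k : is_derive z 1 g d ->
  is_derive z 1 (fun t => k * g t) (k * d).
Proof. exact: is_deriveZ. Qed.

Lemma is_derive_mean n (F : int -> R -> R) (dF : int -> R) z :
  (forall i, is_derive z 1 (F i) (dF i)) ->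
  is_derive z 1 (fun t => mean n (fun i => F i t)) (mean n dF).
Proof.
move=> H; apply: is_derive_mulrl.
by apply: (@is_derive_bigsum _ _ (fun i : nat => F i%:Z) (fun i : nat => dF i%:Z)) => i _.
Qed.

Lemma C21_is_derive A g : is_C21_on A g -> forall x, A x ->
  is_derive x 1 g (derive1 g x) /\ is_derive x 1 (derive1 g) (derive1n 2 g x).
Proof.
move=> [H _] x /H[h1 h2]; split; first by rewrite (derive1E g x); exact: derivableP.
by rewrite [derive1n 2 g x]derive1E; exact: derivableP.
Qed.

Lemma derive1_val g z d : is_derive z 1 g d -> derive1 g z = d.
Proof. by move=> h; rewrite derive1E; exact: derive_val. Qed.

End scalar.

(** * Averaged stresses *)

Section summation_by_parts.
Context {R : realType}.
Implicit Types (u v w t : int -> R) (n m r : nat) (h : R) (k : int).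
Implicit Types (s : nat -> int -> R).

Lemma summation_by_parts n h t v : periodic t n%:Z -> periodic v n%:Z ->
  dotp n t (Diff h 1 v) = - dotp n (fun k => (t k - t (k - 1)) / h) v.
Proof.
move=> ht hv; rewrite /dotp.
rewrite (@mean_eq _ n (fun k => t k * Diff h 1 v k)
  (fun k => h^-1 * (t k * v (k + 1)) - h^-1 * (t k * v k))); last first.
  by move=> k; rewrite Diff1E; ring.
rewrite meanB !meanZ.
have hg : periodic (fun k => t k * v (k + 1)) n%:Z.
  by move=> k; rewrite ht addrAC hv.
rewrite -(mean_shift (-1) hg) -[RHS]mulN1r -!meanZ -meanB.
by apply: mean_eq => k; rewrite subrK; ring.
Qed.

Lemma mean_eq0 n u : (0 < n)%N -> periodic u n%:Z -> (forall k, 0 <= u k) ->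
  mean n u = 0 -> forall k, u k = 0.
Proof.
move=> n0 hu u0 /eqP; rewrite /mean mulf_eq0 invr_eq0 pnatr_eq0 -[(n == 0)%N]negbK -lt0n n0 /=.
rewrite psumr_eq0// => /allP H k; have [j jn ->] := periodic_rep k n0 hu.
by apply/eqP/(H j); rewrite mem_index_iota.
Qed.

(* Testing with the backward difference of [t] itself. *)
Lemma constant_of_orthogonal n h t : (0 < n)%N -> 0 < h -> periodic t n%:Z ->
  (forall v, Usharp n v -> dotp n t (Diff h 1 v) = 0) ->
  forall k, t k = mean n t.
Proof.
move=> n0 h0 ht H; pose v k := t k - t (k - 1).
have hv : periodic v n%:Z by move=> k; rewrite /v addrAC !ht.
have vU : Usharp n v.
  by split=> //; rewrite /v meanB (mean_shift (-1) ht) subrr.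
have v0 k : v k = 0.
  apply/eqP; rewrite -sqrf_eq0; apply/eqP; move: k.
  apply: (@mean_eq0 n) => // [k|k|]; [by rewrite hv|exact: sqr_ge0|].
  have := H v vU; rewrite summation_by_parts// => /eqP; rewrite oppr_eq0.
  rewrite /dotp (@mean_eq _ n _ (fun k => h^-1 * v k ^+ 2)); last first.
    by move=> k; rewrite /v; ring.
  by rewrite meanZ mulf_eq0 invr_eq0 (gt_eqF h0) => /eqP.
have tS k : t (k + 1%N%:Z) = t k 
  by have := v0 (k + 1); rewrite /v addrK => /eqP; rewrite subr_eq0 => /eqP.
have tc k : t k = t 0.
  by rewrite -[k]mulr1 -[_ * _]add0r; exact: (@periodic_mulz _ t 1).
by move=> k; rewrite -[LHS](mean_cst _ n0); apply: mean_eq => j; rewrite !tc.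
Qed.

(** The stress across the bond from k to k + 1: every bond of range r spanning it, that is starting
    at k - i with i < r, contributes with weight 1/r. *)
Definition avg_stress m s k : R :=
  \sum_(1 <= r < m.+1) r%:R^-1 * \sum_(0 <= i < r) s r (k - i%:Z).

Lemma core_avg_stress n h m s v : (forall r, (1 <= r <= m)%N -> periodic (s r) n%:Z) ->
  periodic v n%:Z -> core n h m s v = dotp n (avg_stress m s) (Diff h 1 v).
Proof.
move=> hs hv; rewrite /core /dotp /avg_stress.
rewrite (@mean_eq _ n (fun k => (\sum_(1 <= r < m.+1) _) * _) (fun k => \sum_(1 <= r < m.+1)
  r%:R^-1 * \sum_(0 <= i < r) (s r (k - i%:Z) * Diff h 1 v k))); last first.
  move=> k; rewrite mulr_suml; apply: eq_bigr => r _.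
  by rewrite -mulrA mulr_suml.
rewrite mean_sum big_nat [RHS]big_nat; apply: eq_bigr => r hr.
have r1 : (0 < r)%N by case/andP: hr.
rewrite meanZ mean_sum.
rewrite (@mean_eq _ n _ (fun k => r%:R^-1 * \sum_(0 <= i < r) (s r k * Diff h 1 v (k + i%:Z)))).
  rewrite meanZ mean_sum; congr (_ * _); apply: eq_bigr => i _.
  have hg : periodic (fun k => s r k * Diff h 1 v (k + i%:Z)) n%:Z.
    by move=> k; rewrite (hs r hr) addrAC (Diff_periodic h 1 hv).
  rewrite -(mean_shift (- i%:Z) hg); apply: mean_eq => k; by rewrite subrK.
by move=> k; rewrite Diff_avg// mulrCA -mulr_sumr.
Qed.

Lemma avg_stress_periodic n m s : (forall r, (1 <= r <= m)%N -> periodic (s r) n%:Z) ->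
  periodic (avg_stress m s) n%:Z.
Proof.
move=> hs k; rewrite /avg_stress big_nat [RHS]big_nat; apply: eq_bigr => r hr.
by congr (_ * _); apply: eq_bigr => i _; rewrite addrAC (hs r hr).
Qed.

Lemma mean_avg_stress n m s : (forall r, (1 <= r <= m)%N -> periodic (s r) n%:Z) ->
  mean n (avg_stress m s) = \sum_(1 <= r < m.+1) mean n (s r).
Proof.
move=> hs; rewrite /avg_stress mean_sum big_nat [RHS]big_nat.
apply: eq_bigr => r hr; have r1 : (0 < r)%N by case/andP: hr.
rewrite meanZ mean_sum (eq_bigr (fun=> mean n (s r))); last first.
  by move=> i _; exact: (mean_shift (- i%:Z) (hs r hr)).
rewrite big_const_nat subn0 iter_addr_0 -[X in _ * X]mulr_natl mulrA mulVf ?mul1r//.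
by rewrite pnatr_eq0 -lt0n.
Qed.

(** Equilibrium makes the averaged stress orthogonal to all gradients, hence constant, hence equal
    to its mean; for the corrector this mean is the derivative of Phi^0. *)
Lemma avg_stress_cell n h m s : (0 < n)%N -> 0 < h -> (forall r, (1 <= r <= m)%N -> periodic (s r) n%:Z) ->
  (forall v, Usharp n v -> core n h m s v = 0) ->
  forall k, avg_stress m s k = \sum_(1 <= r < m.+1) mean n (s r).
Proof.
move=> n0 h0 hs H k; rewrite -(mean_avg_stress hs).
apply: (constant_of_orthogonal n0 h0); first exact: avg_stress_periodic.
by move=> v hv; rewrite -core_avg_stress ?H//; case: hv.
Qed.

Lemma avg_stressB m s s' k :
  avg_stress m (fun r j => s r j - s' r j) k = avg_stress m s k - avg_stress m s' k.
Proof.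
rewrite /avg_stress -sumrB; apply: eq_bigr => r _.
by rewrite -mulrBr -sumrB.
Qed.

Lemma avg_stress_le m s k M :
  (forall r (i : nat), (1 <= r <= m)%N -> (i < r)%N -> `|s r (k - i%:Z)| <= M) ->
  `|avg_stress m s k| <= m%:R * M.
Proof.
move=> H; apply: (le_trans (ler_norm_sum _ _ _)).
rewrite [leRHS](_ : _ = \sum_(1 <= r < m.+1) M); last first.
  by rewrite big_const_nat subSS subn0 iter_addr_0 -[RHS]mulr_natl.
rewrite big_nat [leRHS]big_nat; apply: ler_sum => r hr.
have r1 : (0 < r)%N by case/andP: hr.
rewrite normrM ger0_norm ?invr_ge0 ?ler0n// ler_pdivrMl ?ltr0n//.
apply: (le_trans (ler_norm_sum _ _ _)).
rewrite [leRHS](_ : _ = \sum_(0 <= i < r) M); last first.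
  by rewrite big_const_nat subn0 iter_addr_0 -[RHS]mulr_natl.
by rewrite big_nat [leRHS]big_nat; apply: ler_sum => i /andP[_ ir]; exact: H.
Qed.

End summation_by_parts.

(** * Bounds on the potentials by the constants C_Phi *)

Section potentials.
Context {R : realType}.
Variables (p m : nat) (Phi : potential R) (chis : int -> R) (rhoPhi : R).
Hypothesis p0 : (0 < p)%N.
Hypothesis Phi_per : forall (r : nat) (y : int), (1 <= r <= m)%N ->
  Phi r (y + p%:Z) = Phi r y.
Hypothesis chisU : Usharp p chis.
Hypothesis rho0 : 0 < rhoPhi.
Hypothesis smooth : assumption1 m Phi chis rhoPhi.

Let s0 : nat -> int -> R := fun r => Diff 1 r chis.
Let C2 := C2Phi p m Phi chis rhoPhi.
Let C11 := C11Phi p m Phi chis rhoPhi.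

Let domPhiE r k x : domPhi chis rhoPhi r k x <-> `|x - s0 r k| < rhoPhi.
Proof. by rewrite /domPhi -ball_normE /= distrC. Qed.

Let lip (l r : nat) (k : int) : R :=
  lip_const (domPhi chis rhoPhi r k) (derive1n l (Phi r k)).

(** The constants are maxima over the sites 1..p; periodicity of potential and reference strain
    carries them to every site. *)
Lemma domain_rep r (k : int) : (1 <= r <= m)%N -> exists2 j : nat, (1 <= j < p.+1)%N &
  Phi r k = Phi r j%:Z /\ Diff 1 r chis k = Diff 1 r chis j%:Z.
Proof.
move=> hr; have [j [q [hj ->]]] := int_rep k p0; exists j => //; split.
  by apply: (@periodic_mulz _ (Phi r)) => i; exact: Phi_per.
by apply: periodic_mulz; apply: Diff_periodic; case: chisU.
Qed.

Let lip_rep (l r : nat) (k : int) : (1 <= r <= m)%N ->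
  exists2 j : nat, (1 <= j < p.+1)%N & lip l r k = lip l r j%:Z.
Proof.
move=> hr; have [j hj [e1 e2]] := domain_rep k hr.
by exists j; [exact: hj|rewrite /lip /domPhi e1 e2].
Qed.

Let lip_ge0 l r k : 0 <= lip l r k. Proof. exact: lip_const_ge0. Qed.

Lemma C2Phi_ge0 : 0 <= C2.
Proof. by rewrite /C2 /C2Phi le_max; apply/orP; left; exact: bigmax_ge_id. Qed.

Lemma C11Phi_ge0 : 0 <= C11.
Proof. exact: bigmax_ge_id. Qed.

Lemma lip_le_C2Phi l r k : (1 <= r <= m)%N -> (1 <= l <= 2)%N -> lip l r k <= C2.
Proof.
move=> hr hl; have [j hj ->] := lip_rep l k hr.
pose F (l y : nat) := \sum_(1 <= r < m.+1) lip l r y%:Z.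
have h1 : lip l r j%:Z <= F l j.
  rewrite /F (big_rem r) ?mem_index_iota ?ltnS//= lerDl.
  by apply: sumr_ge0 => i _.
apply: (le_trans h1).
have h2 : F l j <= \big[Num.max/0]_(1 <= y < p.+1) F l y.
  by apply: (le_bigmax_seq 0 j xpredT (F l)) => //; rewrite mem_index_iota.
apply: (le_trans h2); rewrite /C2 /C2Phi le_max.
by case: l hl {h1 h2} => [|[|[|l]]] // _; apply/orP; [left|right]; exact: lexx.
Qed.

Lemma lip_le_C11Phi r k : (1 <= r <= m)%N -> lip 1 r k <= C11.
Proof.
move=> hr; have [j hj ->] := lip_rep 1 k hr.
pose F (y : nat) := \sum_(1 <= r < m.+1) r%:R * lip 1 r y%:Z.
have h1 : lip 1 r j%:Z <= F j.
  rewrite /F (big_rem r) ?mem_index_iota ?ltnS//=.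
  apply: ler_wpDr; first by apply: sumr_ge0 => i _; rewrite mulr_ge0.
  by rewrite ler_peMl// ler1n; case/andP: hr.
apply: (le_trans h1).
by apply: (le_bigmax_seq 0 j xpredT F) => //; rewrite mem_index_iota.
Qed.

Lemma potential_is_derive r k x : (1 <= r <= m)%N -> `|x - s0 r k| < rhoPhi ->
  is_derive x 1 (Phi r k) (derive1 (Phi r k) x) /\
  is_derive x 1 (derive1 (Phi r k)) (derive1n 2 (Phi r k) x).
Proof. by move=> hr hx; apply: (C21_is_derive (smooth k hr)); apply/domPhiE. Qed.

Let d2_lip r k x y : (1 <= r <= m)%N ->
  `|x - s0 r k| < rhoPhi -> `|y - s0 r k| < rhoPhi ->
  `|derive1n 2 (Phi r k) x - derive1n 2 (Phi r k) y| <= C2 * `|x - y|.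
Proof.
move=> hr /domPhiE hx /domPhiE hy; have [_ [K /lip_constP H]] := smooth k hr.
by apply: (le_trans (H _ _ hx hy)); rewrite ler_wpM2r// (@lip_le_C2Phi 2).
Qed.

(** [lip_const] is 0 when no Lipschitz constant exists, so it gives a bound only once some constant
    is exhibited; the bounded second derivative provides one. *)
Let d1_lip_ex r k : (1 <= r <= m)%N -> exists K,
  K.-lipschitz_(domPhi chis rhoPhi r k) (derive1 (Phi r k)).
Proof.
move=> hr; exists (`|derive1n 2 (Phi r k) (s0 r k)| + C2 * rhoPhi).
apply/lipschitzP => x y /domPhiE hx /domPhiE hy.
apply: (derive_lipschitz (b := derive1n 2 (Phi r k))) hx hy => t ht.
  exact: (potential_is_derive hr ht).2.
have h0 : `|s0 r k - s0 r k| < rhoPhi by rewrite subrr normr0.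
have := d2_lip hr ht h0; have := C2Phi_ge0 => h1 h2.
rewrite -[derive1n 2 _ t](subrK (derive1n 2 (Phi r k) (s0 r k))) addrC.
apply: (le_trans (ler_normD _ _)); rewrite lerD2l; apply: (le_trans h2).
by rewrite ler_wpM2l// ltW.
Qed.

Lemma stress_lipschitz_C2 r k x y : (1 <= r <= m)%N ->
  `|x - s0 r k| < rhoPhi -> `|y - s0 r k| < rhoPhi ->
  `|derive1 (Phi r k) x - derive1 (Phi r k) y| <= C2 * `|x - y|.
Proof.
move=> hr /domPhiE hx /domPhiE hy; have [K /lip_constP H] := d1_lip_ex k hr.
by apply: (le_trans (H _ _ hx hy)); rewrite ler_wpM2r// (@lip_le_C2Phi 1).
Qed.

Lemma stress_lipschitz_C11 r k x y : (1 <= r <= m)%N ->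
  `|x - s0 r k| < rhoPhi -> `|y - s0 r k| < rhoPhi ->
  `|derive1 (Phi r k) x - derive1 (Phi r k) y| <= C11 * `|x - y|.
Proof.
move=> hr /domPhiE hx /domPhiE hy; have [K /lip_constP H] := d1_lip_ex k hr.
by apply: (le_trans (H _ _ hx hy)); rewrite ler_wpM2r// lip_le_C11Phi.
Qed.

(** C_Phi^(2) includes the Lipschitz constant of the first derivative, which dominates the second
    derivative on the open ball. *)
Lemma stiffness_le_C2 r k x : (1 <= r <= m)%N -> `|x - s0 r k| < rhoPhi ->
  `|derive1n 2 (Phi r k) x| <= C2.
Proof.
move=> hr; apply: (lipschitz_derive_le (a := derive1 (Phi r k)) (L := C2)).
- by move=> t ht; exact: (potential_is_derive hr ht).2.
- by move=> *; exact: d2_lip.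
- by move=> *; exact: stress_lipschitz_C2.
- exact: C2Phi_ge0.
Qed.

Lemma potential_regular : regular m (fun r k => derive1 (Phi r k))
  (fun r k => derive1n 2 (Phi r k)) s0 rhoPhi C2.
Proof.
split=> //; [exact: C2Phi_ge0| |].
- move=> r k x y hr hx hy; split; last exact: d2_lip.
  apply: (derive_remainder (s := s0 r k) (rho := rhoPhi)) hx hy.
  + by move=> t ht; exact: (potential_is_derive hr ht).2.
  + by move=> *; exact: d2_lip.
  + exact: C2Phi_ge0.
- exists C2 => r k hr; apply: stiffness_le_C2 => //.
  by rewrite subrr normr0.
Qed.

End potentials.

(** * The corrector and the homogenized potential *)

Section corrector.
Context {R : realType}.
Variables (p m : nat) (Phi : potential R) (chis : int -> R) (rhoPhi : R).
Hypothesis p0 : (0 < p)%N.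
Hypothesis Phi_per : forall (r : nat) (y : int), (1 <= r <= m)%N ->
  Phi r (y + p%:Z) = Phi r y.
Hypothesis chisU : Usharp p chis.
Hypothesis rhoPhi0 : 0 < rhoPhi.
Hypothesis smooth : assumption1 m Phi chis rhoPhi.
Variables (rhoz rhochi : R) (chi : R -> int -> R).
Variables (c0 rho : R).
Let a (r : nat) (k : int) := derive1 (Phi r k).
Let b (r : nat) (k : int) := derive1n 2 (Phi r k).
Let s0 : nat -> int -> R := fun r => Diff 1 r chis.
Let C2 := C2Phi p m Phi chis rhoPhi.
Let X (u : int -> R) := snorm_inf p 1 1 u.
Let sz z : nat -> int -> R := strain 1 z (chi z).
Hypothesis c00 : 0 < c0.
Hypothesis stab : stable p 1 m (fun r k => b r k (s0 r k)) (2 * c0).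
Hypothesis rho_le : 0 < rho <= rhoPhi.
Hypothesis small : 3 * m%:R * C2 * rho <= c0.

Let C20 : 0 <= C2. Proof. exact: C2Phi_ge0. Qed.
Let rho0 : 0 < rho. Proof. by case/andP: rho_le. Qed.
Let rhoW x : x < rho -> x < rhoPhi.
Proof. by move=> xr; apply: lt_le_trans xr _; case/andP: rho_le. Qed.

Let reg : regular m a b s0 rho C2.
Proof. exact: regular_weak rho_le (potential_regular p0 Phi_per chisU rhoPhi0 smooth). Qed.

Let strain_inball z u : Usharp p u -> `|z| + X (u - chis) < rho ->
  inball m s0 rho (strain 1 z u).
Proof.
move=> hu zu r k /andP[r1 _]; apply: le_lt_trans zu.
rewrite /strain -addrA; apply: (le_trans (ler_normD _ _)); rewrite lerD2l.
rewrite [X in `|X|](_ : _ = Diff 1 r (u - chis) k); last by rewrite DiffB.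
by apply: Diff_le => //; case: (UsharpB hu chisU).
Qed.

(** Newton's method from [chis] produces a cell solution within rho' of it. As rho' <= rhochi it
    lies in the uniqueness ball and must be [chi z]; as rho' <= rho / 2 it comes with the sharper
    closeness needed below. *)
Lemma corrector_branch : assumption2 p m Phi chis ->
  0 < rhoz -> 0 < rhochi -> is_corrector p m Phi chis rhoz rhochi chi ->
  exists r0, [/\ 0 < r0, r0 <= rhoz, r0 <= rho / 2 & forall z, `|z| < r0 ->
    [/\ Usharp p (chi z), X (chi z - chis) < rho / 2 &
        forall v, Usharp p v -> core p 1 m (fun r k => a r k (sz z r k)) v = 0]].
Proof.
move=> eqs rz rc corr.
pose rho' := Num.min (rho / 2) rhochi.
have rho'0 : 0 < rho' by rewrite lt_min rc divr_gt0.
have mC : 0 < m%:R * C2 + 1 by rewrite ltr_wpDl// mulr_ge0.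
(* At [chis] the residual is at most m C2 |z|; the last entry keeps it below c0 rho'. *)
exists (Num.min (Num.min rhoz (rho / 2)) (c0 * rho' / (m%:R * C2 + 1))); split.
- by rewrite !lt_min rz !divr_gt0// mulr_gt0.
- by rewrite !ge_min lexx.
- by rewrite !ge_min lexx orbT.
move=> z; rewrite !lt_min => /andP[/andP[z1 z2] z3].
have hM : m%:R * (C2 * `|z|) < c0 * rho'.
  rewrite ltr_pdivlMr// in z3; apply: le_lt_trans z3.
  by rewrite mulrA mulrC ler_wpM2l// lerDl.
have [||||u [hu Xu su]] := @nonlinear_solution _ p m 1 a b s0 rho C2 c0 p0 ltr01 c00
    reg stab small z chis (fun=> 0) rho' (m%:R * (C2 * `|z|)) chisU.
- by move=> x u v; rewrite mulr0 addr0.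
- move=> u hu ur; apply: strain_inball => //.
  rewrite [ltRHS]splitr ltrD//; apply: (lt_le_trans ur).
  by rewrite /rho' ge_min lexx.
- apply: eq_dbound (dbound_core (s := fun r k => a r k (s0 r k) - a r k (strain 1 z chis r k))
      p 1 _ _) => [v hv||r k hr].
  + rewrite coreB; congr (_ - _); exact: (eqs v hv).
  + by rewrite mulr_ge0.
  + have -> : `|z| = `|s0 r k - strain 1 z chis r k|.
      by rewrite distrC /strain addrK.
    apply: (stress_lipschitz_C2 p0 Phi_per chisU rhoPhi0 smooth) => //.
      by rewrite subrr normr0.
    by rewrite /strain addrK; apply: rhoW; have := rho0; lra.
- exact: hM.
have Xr : X (u - chis) < rho'.
  by apply: (le_lt_trans Xu); rewrite ltr_pdivrMr// [ltRHS]mulrC.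
have [_ uniq] := corr z z1.
have cu : u = chi z.
  apply: uniq; split=> //; apply: (lt_le_trans Xr).
  by rewrite /rho' ge_min lexx orbT.
rewrite /sz -cu; split=> //; apply: (lt_le_trans Xr).
by rewrite /rho' ge_min lexx.
Qed.

Variable r0 : R.
Hypothesis r0_gt0 : 0 < r0.
Hypothesis r0_le : r0 <= rho / 2.
Hypothesis branch : forall z, `|z| < r0 ->
    [/\ Usharp p (chi z), X (chi z - chis) < rho / 2 &
        forall v, Usharp p v -> core p 1 m (fun r k => a r k (sz z r k)) v = 0].

Let chiU z : `|z| < r0 -> Usharp p (chi z). Proof. by case/branch. Qed.

(** rho is shared, one half for the offset and one for the corrector, so the two may belong to
    different macroscopic strains. *)
Let mixed_inball z z' : `|z| < r0 -> `|z'| < r0 ->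
  inball m s0 rho (strain 1 z' (chi z)).
Proof.
move=> hz hz'; have [hu Xu _] := branch hz; apply: strain_inball => //.
by rewrite [ltRHS]splitr ltrD// (lt_le_trans hz').
Qed.

Let sz_inball z : `|z| < r0 -> inball m s0 rho (sz z).
Proof. by move=> hz; exact: mixed_inball. Qed.

(** Both correctors are compared at the offset z; changing the offset of the second from z' to z
    costs m K |z - z'|. K is left free so that it can be either C_Phi^(2) or C_Phi^(1,1). *)
Lemma corrector_lipschitz K z z' : 0 <= K ->
  (forall (r : nat) k x y, (1 <= r <= m)%N -> `|x - s0 r k| < rhoPhi ->
     `|y - s0 r k| < rhoPhi -> `|a r k x - a r k y| <= K * `|x - y|) ->
  `|z| < r0 -> `|z'| < r0 -> c0 * X (chi z - chi z') <= m%:R * K * `|z - z'|.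
Proof.
move=> K0 HK hz hz'.
have [hu _ eu] := branch hz; have [hu' _ eu'] := branch hz'.
apply: (nonlinear_stability p0 reg stab small (s := strain 1 z (chi z))
  (t := strain 1 z (chi z')) (mixed_inball hz hz) (mixed_inball hz' hz) (UsharpB hu hu')).
  by move=> r k _; rewrite DiffB /strain !fctE; ring.
rewrite -mulrA; apply: eq_dbound (dbound_core (s := fun r k =>
  a r k (sz z' r k) - a r k (strain 1 z (chi z') r k)) p 1 _ _) => [v hv||r k hr].
- by rewrite !coreB eu'// eu.
- by rewrite mulr_ge0.
- have -> : `|z - z'| = `|sz z' r k - strain 1 z (chi z') r k|.
    by rewrite distrC /sz /strain opprD addrACA subrr addr0.
  by apply: HK => //; apply: rhoW; [exact: sz_inball|exact: mixed_inball].
Qed.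

Let Lx := m%:R * C2 / c0.
Let Lx0 : 0 <= Lx. Proof. by rewrite divr_ge0 ?mulr_ge0// ltW. Qed.

Let chi_lip z z' : `|z| < r0 -> `|z'| < r0 -> X (chi z - chi z') <= Lx * `|z - z'|.
Proof.
move=> hz hz'; rewrite -(ler_pM2l c00) /Lx.
apply: (le_trans (corrector_lipschitz C20 _ hz hz')).
  exact: (stress_lipschitz_C2 p0 Phi_per chisU rhoPhi0 smooth).
by rewrite le_eqVlt; apply/orP; left; apply/eqP; field; rewrite gt_eqF.
Qed.

Let strain_lip z z' r k : `|z| < r0 -> `|z'| < r0 -> (1 <= r)%N ->
  `|sz z r k - sz z' r k| <= (1 + Lx) * `|z - z'|.
Proof.
move=> hz hz' r1.
have -> : sz z r k - sz z' r k = (z - z') + Diff 1 r (chi z - chi z') k.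
  by rewrite DiffB /sz /strain !fctE; ring.
apply: (le_trans (ler_normD _ _)); rewrite mulrDl mul1r lerD2l.
apply: (le_trans _ (chi_lip hz hz')); apply: Diff_le => //.
by case: (UsharpB (chiU hz) (chiU hz')).
Qed.

(* The derivative of the corrector, from the linearised cell problem. *)
Lemma corrector_derivative_ex : exists dchi : R -> int -> R, forall z, `|z| < r0 ->
  Usharp p (dchi z) /\ forall v, Usharp p v ->
  core p 1 m (fun r k => b r k (sz z r k) * (1 + Diff 1 r (dchi z) k)) v = 0.
Proof.
suff /choice[d hd] : forall z, exists w, `|z| < r0 -> Usharp p w /\ forall v, Usharp p v ->
  core p 1 m (fun r k => b r k (sz z r k) * (1 + Diff 1 r w k)) v = 0 by exists d.
move=> z; have [hz|nz] := pselect (`|z| < r0); last by exists 0.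
have [|w hw1 hw2] := linear_solution p0 ltr01 c00 reg stab small (sz_inball hz)
    (l := fun v => - core p 1 m (fun r k => b r k (sz z r k)) v).
  by move=> x u v; rewrite core_lin; ring.
exists w => _; split=> // v hv; have := hw2 v hv => /eqP.
rewrite -subr_eq0 opprK -coreD => /eqP <-; apply: eq_core => r k _.
by rewrite mulrDr mulr1 addrC.
Qed.

Variable dchi : R -> int -> R.
Hypothesis dchiP : forall z, `|z| < r0 -> Usharp p (dchi z) /\
  forall v, Usharp p v ->
  core p 1 m (fun r k => b r k (sz z r k) * (1 + Diff 1 r (dchi z) k)) v = 0.

Let b_le z r k : `|z| < r0 -> (1 <= r <= m)%N -> `|b r k (sz z r k)| <= C2.
Proof.
move=> hz hr; apply: (stiffness_le_C2 p0 Phi_per chisU rhoPhi0 smooth) => //.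
by apply/rhoW/sz_inball.
Qed.

Let b_lip z z' r k : `|z| < r0 -> `|z'| < r0 -> (1 <= r <= m)%N ->
  `|b r k (sz z r k) - b r k (sz z' r k)| <= C2 * (1 + Lx) * `|z - z'|.
Proof.
move=> hz hz' hr; case: reg => _ _ H _.
have [_ H2] := H r k _ _ hr (sz_inball hz k hr) (sz_inball hz' k hr).
apply: (le_trans H2); rewrite -mulrA ler_wpM2l//; apply: strain_lip => //.
by case/andP: hr.
Qed.

Let dchi_le z : `|z| < r0 -> X (dchi z) <= Lx.
Proof.
move=> hz; have [dU de] := dchiP hz; rewrite /Lx ler_pdivlMr// mulrC.
apply: (linear_stability p0 reg stab small (sz_inball hz) dU).
apply: eq_dbound (dbound_core (s := fun r k => - b r k (sz z r k)) p 1 _ _)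
    => [v hv||r k hr]; last 2 first.
- exact: C20.
- by rewrite normrN b_le.
have := de v hv => /eqP.
rewrite (@eq_core _ p 1 m _ (fun r k => b r k (sz z r k) * Diff 1 r (dchi z) k
  - (- b r k (sz z r k)))); last by move=> r k _; ring.
by rewrite coreB subr_eq0 => /eqP.
Qed.

Let ddchi_le z r k : `|z| < r0 -> (1 <= r)%N -> `|1 + Diff 1 r (dchi z) k| <= 1 + Lx.
Proof.
move=> hz r1; apply: (le_trans (ler_normD _ _)); rewrite normr1 lerD2l.
apply: (le_trans _ (dchi_le hz)); apply: Diff_le => //.
by have [[]] := dchiP hz.
Qed.

Let dchi_lip z z' : `|z| < r0 -> `|z'| < r0 ->
  X (dchi z - dchi z') <= Lx * (1 + Lx) ^+ 2 * `|z - z'|.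
Proof.
move=> hz hz'; have [dU de] := dchiP hz; have [dU' de'] := dchiP hz'.
have -> : Lx * (1 + Lx) ^+ 2 * `|z - z'| =
    m%:R * (C2 * (1 + Lx) * `|z - z'| * (1 + Lx)) / c0 by rewrite /Lx; ring.
rewrite ler_pdivlMr// mulrC.
apply: (linear_stability p0 reg stab small (sz_inball hz) (UsharpB dU dU')).
apply: eq_dbound (dbound_core (s := fun r k =>
    (b r k (sz z' r k) - b r k (sz z r k)) * (1 + Diff 1 r (dchi z') k)) p 1 _ _)
    => [v hv||r k hr].
- pose S r k := b r k (sz z r k) * (1 + Diff 1 r (dchi z) k).
  pose S' r k := b r k (sz z' r k) * (1 + Diff 1 r (dchi z') k).
  pose T r k := b r k (sz z r k) * (1 + Diff 1 r (dchi z') k).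
  (* Both linearised cell equations have zero right-hand side, so the term at z' may be exchanged
     for the term at z; what remains contains the stiffness at z alone. *)
  have swap U U' V : core p 1 m U v = 0 -> core p 1 m U' v = 0 ->
      core p 1 m (fun r k => U' r k - V r k) v = core p 1 m (fun r k => U r k - V r k) v.
    by move=> e e'; rewrite !coreB e e'.
  transitivity (core p 1 m (fun r k => S' r k - T r k) v).
    by apply: eq_core => r k _; rewrite /S' /T mulrBl.
  rewrite (swap S S' T (de v hv) (de' v hv)); apply: eq_core => r k _.
  by rewrite /S /T DiffBE -mulrBr opprD addrACA subrr add0r.
- by rewrite !mulr_ge0// addr_ge0.
- rewrite normrM ler_pM//; first by rewrite distrC b_lip.
  by apply: ddchi_le => //; case/andP: hr.
Qed.

Let chi_remainder z z' : `|z| < r0 -> `|z'| < r0 ->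
  X (chi z' - chi z - (z' - z) *: dchi z) <= Lx * (1 + Lx) ^+ 2 * `|z' - z| ^+ 2.
Proof.
move=> hz hz'; have [dU de] := dchiP hz.
have [hu _ eu] := branch hz; have [hu' _ eu'] := branch hz'.
have -> : Lx * (1 + Lx) ^+ 2 * `|z' - z| ^+ 2 =
    m%:R * (C2 * ((1 + Lx) * `|z' - z|) ^+ 2) / c0 by rewrite /Lx; ring.
rewrite ler_pdivlMr// mulrC.
apply: (linear_stability p0 reg stab small (sz_inball hz)
  (UsharpB (UsharpB hu' hu) (UsharpZ _ dU))).
apply: eq_dbound (dbound_core (s := fun r k => b r k (sz z r k) * (sz z' r k - sz z r k)
    - (a r k (sz z' r k) - a r k (sz z r k))) p 1 _ _)
    => [v hv||r k hr].
- rewrite coreB [core _ _ _ (fun r k => a r k _ - _) v]coreB eu'// eu// !subr0.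
  (* Adding z' - z times the linearised cell equation, which is zero, cancels the offset part of the
     strain increment. *)
  rewrite -[RHS]addr0 -[X in _ + X](mulr0 (z' - z)) -(de v hv) -coreZ -coreD.
  apply: eq_core => r k _.
  by rewrite /sz /strain !DiffB DiffZ !fctE /GRing.scale /=; ring.
- by rewrite mulr_ge0// exprn_ge0// mulr_ge0// addr_ge0.
- case: reg => _ _ H _.
  have [H1 _] := H r k _ _ hr (sz_inball hz' k hr) (sz_inball hz k hr).
  rewrite distrC; apply: (le_trans H1); rewrite ler_wpM2l//.
  rewrite lerXn2r ?nnegrE//; first by rewrite mulr_ge0// addr_ge0.
  by apply: strain_lip => //; case/andP: hr.
Qed.

Let chi_is_derive (z : R) k : `|z| < r0 -> is_derive z 1 (fun t => chi t k) (dchi z k).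
Proof.
move=> hz; have [dU de] := dchiP hz.
apply: (@remainder_is_derive _ _ z _ (p%:R * (Lx * (1 + Lx) ^+ 2)) (r0 - `|z|)).
- by rewrite subr_gt0.
- by rewrite mulr_ge0// mulr_ge0// exprn_ge0// addr_ge0.
move=> t ht; have ht' : `|t| < r0.
  rewrite -[t](subrK z); apply: (le_lt_trans (ler_normD _ _)).
  by rewrite -ltrBrDr.
have hU := UsharpB (UsharpB (chiU ht') (chiU hz)) (UsharpZ (t - z) dU).
have := Usharp_sup_le k p0 ltr01 hU; rewrite mulr1.
have := chi_remainder hz ht'.
rewrite [X in 2 * `|X|](_ : _ = chi t k - chi z k - dchi z k * (t - z)); last first.
  by rewrite !fctE /GRing.scale /=; ring.
rewrite -/(X _); set Y := X _; set B := Lx * _ * _ => h1 h2.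
have h3 : p%:R * Y <= p%:R * B by rewrite ler_wpM2l.
rewrite -mulrA -/B; apply: (@le_trans _ _ (2 * `|chi t k - chi z k - dchi z k * (t - z)|)).
  by rewrite ler_peMl// ler1n.
exact: le_trans h3.
Qed.

Let strain_is_derive (z : R) r k : `|z| < r0 ->
  is_derive z 1 (fun t => sz t r k) (1 + Diff 1 r (dchi z) k).
Proof.
move=> hz; rewrite /sz /strain /Diff.
rewrite (_ : (fun t => _) = id + (fun t => (r%:R * 1)^-1 * (chi t (k + r%:Z) - chi t k))).
  rewrite [X in 1 + X]mulrC; apply: is_deriveD.
  by apply/is_derive_mulrl/is_deriveB; exact: chi_is_derive.
by apply/funext => t; rewrite !fctE mulrC.
Qed.

Let average_is_derive (G dG : nat -> int -> R -> R) (z : R) : `|z| < r0 ->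
  (forall r k, (1 <= r <= m)%N -> is_derive (sz z r k) 1 (G r k) (dG r k (sz z r k))) ->
  is_derive z 1 (fun t => \sum_(1 <= r < m.+1) mean p (fun k => G r k (sz t r k)))
    (\sum_(1 <= r < m.+1) mean p (fun k => dG r k (sz z r k) * (1 + Diff 1 r (dchi z) k))).
Proof.
move=> hz HG; apply: is_derive_bigsum => r; rewrite mem_index_iota ltnS => hr.
apply: is_derive_mean => k.
exact: (@is_derive1_comp _ (G r k) (fun t => sz t r k) z _ _ (HG r k hr) (strain_is_derive r k hz)).
Qed.

Let dPhi0 (z : R) := \sum_(1 <= r < m.+1) mean p (fun k => a r k (sz z r k)).
Let ddPhi0 (z : R) := \sum_(1 <= r < m.+1)
  mean p (fun k => b r k (sz z r k) * (1 + Diff 1 r (dchi z) k)).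

(** The contribution of the derivative of the corrector is the cell equation tested with [dchi z],
    hence zero. *)
Let Phi0_is_derive (z : R) : `|z| < r0 -> is_derive z 1 (Phi0 p m Phi chi) (dPhi0 z).
Proof.
move=> hz; apply: is_derive_eq.
  apply: (@average_is_derive Phi a z hz) => r k hr.
  apply: (potential_is_derive smooth hr _).1; apply: rhoW; exact: sz_inball.
have [dU _] := dchiP hz; have [_ _ eu] := branch hz.
rewrite -[RHS]addr0 -[X in _ = _ + X](eu _ dU) /dPhi0 /core -big_split; apply: eq_bigr => r _ /=.
by rewrite /dotp -meanD; apply: mean_eq => k; rewrite mulrDr mulr1.
Qed.

Lemma derive1_Phi0 z : `|z| < r0 -> derive1 (Phi0 p m Phi chi) z =
  \sum_(1 <= r < m.+1) mean p (fun k => derive1 (Phi r k) (z + Diff 1 r (chi z) k)).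
Proof. by move=> hz; exact: (derive1_val (Phi0_is_derive hz)). Qed.

Let dPhi0_is_derive (z : R) : `|z| < r0 ->
  is_derive z 1 (derive1 (Phi0 p m Phi chi)) (ddPhi0 z).
Proof.
(* The formula [dPhi0] for the first derivative holds only for |z| < r0, so it is transferred on a
   neighbourhood of z. *)
move=> hz; apply: (@near_eq_is_derive _ _ _ dPhi0); last first.
  apply: (@average_is_derive a b z hz) => r k hr.
  apply: (potential_is_derive smooth hr _).2; apply: rhoW; exact: sz_inball.
have d0 : 0 < r0 - `|z| by rewrite subr_gt0.
near=> t; rewrite derive1_Phi0//.
have ht : `|z - t| < r0 - `|z|.
  by near: t; have := nbhsx_ballx z _ d0; rewrite -ball_normE; exact.
rewrite -[t](subrK z); apply: (le_lt_trans (ler_normD _ _)).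
by rewrite -ltrBrDr distrC.
Unshelve. all: by end_near. Qed.

(** With Lx = m C2 / c0, varying the stiffness costs C2 (1 + Lx)^2 and varying [dchi] costs C2 Lx (1
    + Lx)^2 for each range; they add up to C2 (1 + Lx)^3, and m ranges are summed. *)
Lemma Phi0_regular : regular 1 (fun _ _ => derive1 (Phi0 p m Phi chi))
  (fun _ _ => derive1n 2 (Phi0 p m Phi chi)) (fun _ _ => 0) r0
  (m%:R * C2 * (1 + m%:R * C2 / c0) ^+ 3).
Proof.
rewrite -/Lx; set L := _ * _ ^+ 3.
have L0 : 0 <= L by rewrite mulr_ge0 ?exprn_ge0 ?addr_ge0 ?(mulr_ge0 (ler0n _ m)).
have dd (z : R) : `|z - 0| < r0 -> is_derive z 1 (derive1 (Phi0 p m Phi chi))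
    (derive1n 2 (Phi0 p m Phi chi) z).
  rewrite subr0 => hz; apply: is_derive_eq; first exact: dPhi0_is_derive.
  by rewrite [RHS](derive1_val (dPhi0_is_derive hz)).
have lip x y : `|x - 0| < r0 -> `|y - 0| < r0 ->
   `|derive1n 2 (Phi0 p m Phi chi) x - derive1n 2 (Phi0 p m Phi chi) y| <= L * `|x - y|.
  rewrite !subr0 => hx hy.
  rewrite [derive1n 2 _ x](derive1_val (dPhi0_is_derive hx)).
  rewrite [derive1n 2 _ y](derive1_val (dPhi0_is_derive hy)).
  rewrite /ddPhi0 -sumrB; apply: (le_trans (ler_norm_sum _ _ _)).
  have -> : L * `|x - y| = \sum_(1 <= r < m.+1) (C2 * (1 + Lx) ^+ 3 * `|x - y|).
    by rewrite big_const_nat subSS subn0 iter_addr_0 /L -[RHS]mulr_natl; ring.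
  rewrite big_nat [leRHS]big_nat; apply: ler_sum => r hr.
  have r1 : (1 <= r)%N by case/andP: hr.
  rewrite -meanB; apply: (le_trans (mean_norm _ _)).
  rewrite -[leRHS](mean_cst _ p0); apply: mean_le => k.
  rewrite (_ : _ - _ = (b r k (sz x r k) - b r k (sz y r k)) * (1 + Diff 1 r (dchi x) k)
    + b r k (sz y r k) * Diff 1 r (dchi x - dchi y) k); last first.
    rewrite DiffBE; move: (b r k _) (b r k _) (Diff _ _ _ _) (Diff _ _ _ _).
    by move=> *; ring.
  have -> : C2 * (1 + Lx) ^+ 3 * `|x - y| = C2 * (1 + Lx) * `|x - y| * (1 + Lx)
    + C2 * (Lx * (1 + Lx) ^+ 2 * `|x - y|) by ring.
  apply: (le_trans (ler_normD _ _)).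
  rewrite (normrM (_ - _)) (normrM (b _ _ _)) lerD// ler_pM//.
  - exact: b_lip.
  - exact: ddchi_le.
  - exact: b_le.
  - apply: (@le_trans _ _ (X (dchi x - dchi y))); last exact: dchi_lip.
    have hD := UsharpB (dchiP hx).1 (dchiP hy).1.
    by apply: Diff_le => //; case: hD.
split=> //; last by exists `|derive1n 2 (Phi0 p m Phi chi) 0|.
move=> r k x y _ hx hy; split; last exact: lip.
exact: (derive_remainder dd lip L0).
Qed.

End corrector.

(** * Atomistic and homogenized equilibria *)

Section lattice_vs_cell.
Context {R : realType}.
Implicit Types (u v : int -> R) (n m p : nat).

Lemma eps_gt0 n : (0 < n)%N -> 0 < eps n :> R.
Proof. by move=> n0; rewrite invr_gt0 ltr0n. Qed.

Lemma periodic_dvdn (T : Type) p n (u : int -> T) : (p %| n)%N ->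
  (forall k, u (k + p%:Z) = u k) -> forall k, u (k + n%:Z) = u k.
Proof.
move=> /dvdnP[d ->] hu k; rewrite -[RHS](periodic_mulz k d%:Z hu).
by congr u; lia.
Qed.

(** A double average of u (k + j) over a cell and over n sites: shift invariance evaluates the inner
    mean in either order. *)
Lemma mean_dvdn p n u : (0 < p)%N -> (0 < n)%N -> (p %| n)%N -> periodic u p%:Z ->
  mean n u = mean p u.
Proof.
move=> p0 n0 pn hu; have hn := periodic_dvdn pn hu.
rewrite -[LHS](mean_cst _ p0) -[RHS](mean_cst _ n0).
transitivity (mean p (fun j => mean n (fun k => u (k + j)))).
  by apply: mean_eq => j; rewrite mean_shift.
transitivity (mean n (fun k => mean p (fun j => u (j + k)))); last first.
  by apply: mean_eq => k; rewrite mean_shift.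
rewrite /mean -!mulr_sumr mulrCA exchange_big /=; congr (_ * (_ * _)).
by apply: eq_bigr => i _; apply: eq_bigr => j _; rewrite addrC.
Qed.

Lemma Usharp_dvdn p n u : (0 < p)%N -> (0 < n)%N -> (p %| n)%N -> Usharp p u -> Usharp n u.
Proof.
move=> p0 n0 pn [hu mu]; split; first exact: periodic_dvdn hu.
by rewrite (mean_dvdn p0 n0 pn hu).
Qed.

Lemma Diff_eps n r u : (0 < n)%N -> Diff (eps n) r (eps n *: u) = Diff 1 r u.
Proof.
move=> n0; apply/funext => k; rewrite /Diff !fctE /GRing.scale /= -mulrBr invfM mulr1.
have e1 : eps n * (eps n)^-1 = 1 :> R by rewrite mulfV// gt_eqF// eps_gt0.
by rewrite -[RHS]mulr1 -e1; ring.
Qed.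

Lemma dotp_cst_Diff n h t c v : periodic v n%:Z -> (forall k, t k = c) ->
  dotp n t (Diff h 1 v) = 0.
Proof.
move=> hv tc; rewrite /dotp (@mean_eq _ n _ (fun k => c * Diff h 1 v k)).
  by rewrite meanZ mean_Diff// mulr0.
by move=> k; rewrite tc.
Qed.

Lemma dotp_Diff_le n h t v M : (forall k, `|t k| <= M) ->
  dotp n t (Diff h 1 v) <= M * snorm_one n h 1 v.
Proof.
move=> tM; apply: (le_trans (ler_norm _)); apply: (le_trans (mean_norm _ _)).
rewrite snorm_one1E -meanZ; apply: mean_le => k.
by rewrite normrM ler_wpM2r.
Qed.

Lemma Usharp_orthogonal n u : (0 < n)%N -> Usharp n u ->
  (forall v, Usharp n v -> dotp n u v = 0) -> forall k, u k = 0.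
Proof.
move=> n0 uU H k; apply/eqP; rewrite -sqrf_eq0; apply/eqP; move: k.
apply: (@mean_eq0 _ n) => // [k|k|]; [by rewrite (proj1 uU)|exact: sqr_ge0|].
exact: H.
Qed.

Lemma core1E n h (a : R -> R) (e : nat -> int -> R) v :
  core n h 1 (fun r k => a (e r k)) v = dotp n (fun k => a (e 1%N k)) (Diff h 1 v).
Proof. by rewrite /core big_nat1. Qed.

Lemma two_norm_inf_le n u : (0 < n)%N -> Usharp n u ->
  2 * norm_inf n u <= snorm_inf n (eps n) 1 u.
Proof.
move=> n0 uU; rewrite mulrC -ler_pdivlMr//; apply: norm_inf_le.
  by rewrite divr_ge0 ?snorm_inf_ge0.
move=> k; rewrite ler_pdivlMr// mulrC.
have := Usharp_sup_le k n0 (eps_gt0 n0) uU.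
by rewrite mulfV ?mul1r// pnatr_eq0 -lt0n.
Qed.

(** y + chis y increases and gains exactly p over a period, so a single step 1 + D chis lies between
    0 and p. For p = 1 the step is the whole period. *)
Lemma assumption0_snorm p chis : (0 < p)%N -> periodic chis p%:Z ->
  assumption0 (R := R) chis -> snorm_inf p 1 1 chis <= p%:R.
Proof.
move=> p0 hc incr; apply: norm_inf_le => // k.
rewrite /= Diff1E divr1 ler_norml.
have h1 : k%:~R + chis k < (k + 1)%:~R + chis (k + 1) by apply: incr; lia.
have h2 : (k + 1)%:~R + chis (k + 1) <= (k + p%:Z)%:~R + chis (k + p%:Z).
  have [->//|p1] := eqVneq p 1%N.
  by apply: ltW; apply: incr; lia.
rewrite hc !intrD in h1 h2.
have p1 : (1 : R) <= p%:R by rewrite ler1n.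
rewrite -pmulrn in h2.
by apply/andP; split; lra.
Qed.

Lemma shift_le (e : int -> R) d k (i l : nat) :
  (forall j, `|e (j + 1) - e j| <= d) -> `|e (k - i%:Z + l%:Z) - e k| <= (i%:R + l%:R) * d.
Proof.
move=> H; have up j (q : nat) : `|e (j + q%:Z) - e j| <= q%:R * d.
  elim: q => [|q ih]; first by rewrite addr0 subrr normr0 mul0r.
  rewrite (_ : _ - _ = (e (j + q%:Z + 1) - e (j + q%:Z)) + (e (j + q%:Z) - e j)).
    by apply: (le_trans (ler_normD _ _)); rewrite -natr1 mulrDl mul1r addrC lerD.
  by rewrite (_ : j + q.+1%:Z = j + q%:Z + 1); [ring|lia].
have h1 := up (k - i%:Z) l; have h2 := up (k - i%:Z) i; rewrite subrK distrC in h2.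
rewrite (_ : _ - e k = (e (k - i%:Z + l%:Z) - e (k - i%:Z)) + (e (k - i%:Z) - e k)).
  by apply: (le_trans (ler_normD _ _)); rewrite mulrDl addrC lerD.
by ring.
Qed.

End lattice_vs_cell.

Section atomistic.
Context {R : realType}.
Variables (N p m : nat) (Phi : potential R) (chis : int -> R) (rhoPhi : R).
Hypotheses (p0 : (0 < p)%N) (N0 : (0 < N)%N) (pN : (p %| N)%N).
Hypothesis Phi_per : forall (r : nat) (y : int), (1 <= r <= m)%N ->
  Phi r (y + p%:Z) = Phi r y.
Hypothesis chisU : Usharp p chis.
Hypothesis smooth : assumption1 m Phi chis rhoPhi.
Let h : R := eps N.
Let a (r : nat) (k : int) := derive1 (Phi r k).

(** Assumption 2 tests with p-periodic functions only. It forces the averaged stress to be constant,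
    and a constant is orthogonal to the gradient of every N-periodic test function. *)
Lemma equilibrium_chis v : assumption2 p m Phi chis -> Usharp N v ->
  core N h m (fun r k => a r k (Diff h r (h *: chis) k)) v = 0.
Proof.
move=> eqs [hv _]; pose s r k := a r k (Diff 1 r chis k).
have hs (r : nat) : (1 <= r <= m)%N -> periodic (s r) p%:Z.
  by move=> hr k; rewrite /s /a Phi_per// Diff_periodic//; case: chisU.
rewrite (@eq_core _ N h m _ s); last by move=> r k _; rewrite Diff_eps.
rewrite core_avg_stress//; last by move=> r hr; exact: (periodic_dvdn pN (hs r hr)).
exact: (dotp_cst_Diff _ hv (avg_stress_cell p0 ltr01 hs eqs)).
Qed.

Lemma dE_core u v : snorm_inf N h 1 (u - h *: chis) < rhoPhi -> periodic u N%:Z ->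
  dE N m Phi u v = core N h m (fun r k => a r k (Diff h r u k)) v.
Proof.
move=> ur hu; apply: derive1_val.
rewrite /core /dotp -mean_sum.
apply: is_derive_mean => k; apply: is_derive_bigsum => r.
rewrite mem_index_iota ltnS => hr.
have E : (fun t : R => Diff h r (u + t *: v) k) = cst (Diff h r u k) + (fun t => Diff h r v k * t).
  by apply/funext => t; rewrite DiffD DiffZ !fctE /GRing.scale /= mulrC.
have E0 : Diff h r (u + 0 *: v) k = Diff h r u k by rewrite scale0r addr0.
apply: (@is_derive1_comp _ (Phi r k) (fun t => Diff h r (u + t *: v) k)).
  rewrite E0; apply: (potential_is_derive smooth hr _).1.
  apply: le_lt_trans ur; rewrite -(Diff_eps r chis N0).
  rewrite [X in `|X|](_ : _ = Diff h r (u - h *: chis) k); last by rewrite DiffB.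
  apply: Diff_le => //; last by case/andP: hr.
  by move=> j; rewrite !fctE hu (periodic_dvdn pN (proj1 chisU)).
rewrite E; have D1 := is_derive_cst (Diff h r u k) (0 : R) (1 : R).
have D2 := is_derive_mulrl (Diff h r v k) (is_derive_id (0 : R) (1 : R)).
by apply: is_derive_eq (is_deriveD D1 D2) _; rewrite add0r mulr1.
Qed.

Lemma atomistic_solutionE f u : snorm_inf N h 1 (u - h *: chis) < rhoPhi ->
  periodic u N%:Z -> atomistic_solution N m Phi f u <-> equilibrium N m a f u.
Proof.
by move=> ur hu; split=> H v hv; have := H v hv; rewrite dE_core.
Qed.

End atomistic.

Section homogenized.
Context {R : realType}.
Variables (N : nat) (phi : R -> R) (rho L c : R).
Let h : R := eps N.
Let a (_ : nat) (_ : int) := derive1 phi.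
Let b (_ : nat) (_ : int) := derive1n 2 phi.
Hypotheses (N0 : (0 < N)%N) (c0 : 0 < c).
Hypothesis reg : regular 1 a b (fun _ _ => 0) rho L.
Hypothesis small : 3 * 1%:R * L * rho <= c.
Hypothesis convex : 2 * c <= derive1n 2 phi 0.

(** A pointwise argument on the strong form: f (k + 1) is minus the difference quotient of the
    stress, and the stress has slope at least 2c - c, by the lower bound on the second derivative at
    0. *)
Lemma second_difference_bound f u : Usharp N f -> Usharp N u ->
  snorm_inf N h 1 u < rho -> equilibrium N 1 a f u ->
  snorm_inf N h 2 u <= c^-1 * norm_inf N f.
Proof.
move=> [hf mf] [hu mu] ur eq; have h0 : 0 < h by exact: eps_gt0.
pose e := Diff h 1 u; have he : periodic e N%:Z by exact: Diff_periodic.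
have eb k : `|e k - 0| < rho.
  by rewrite subr0; apply: le_lt_trans ur; exact: le_norm_inf.
pose t k := derive1 phi (e k); have ht : periodic t N%:Z by move=> k; rewrite /t he.
(* The residual of the strong form. Both terms have zero mean, so the residual is itself a test
   function and must vanish. *)
pose g k := f k + (t k - t (k - 1)) / h.
have ft : forall k, g k = 0.
  apply: (@Usharp_orthogonal _ N) => //.
    split; first by move=> k; rewrite /g hf addrAC !ht.
    rewrite /g meanD mf add0r (@mean_eq _ N _ (fun k => h^-1 * (t k - t (k - 1)))).
      by rewrite meanZ meanB (mean_shift (-1) ht) subrr mulr0.
    by move=> k; rewrite mulrC.
  move=> v hv; rewrite (_ : g = f + (fun k => (t k - t (k - 1)) / h))// dotpDl.
  rewrite -(eq v hv) core1E.
  have := summation_by_parts h ht (proj1 hv); rewrite /t /e => ->.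
  by rewrite addNr.
apply: norm_inf_le => [|k]; first by rewrite mulr_ge0 ?norm_inf_ge0 ?invr_ge0 ?(ltW c0).
rewrite /= -/e Diff1E ler_pdivlMl//.
have fk : f (k + 1) = - ((t (k + 1) - t k) / h).
  by have := ft (k + 1); rewrite /g addrK => /eqP; rewrite addr_eq0 => /eqP.
apply: (@le_trans _ _ `|f (k + 1)|); last exact: le_norm_inf.
rewrite fk normrN !normrM mulrA ler_wpM2r//.
have := @regular_strong _ 1 a b (fun _ _ => 0) rho L 1%N k _ _ reg isT (eb (k + 1)) (eb k).
rewrite /a -/(t _) -/(t _); set d := e (k + 1) - e k => H.
have H1 : `|t (k + 1) - t k - b 1%N k 0 * d| <= c * `|d|.
  by apply: (le_trans H); rewrite ler_wpM2r//; have := small; rewrite mulr1.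
have H2 : 2 * c * `|d| <= `|b 1%N k 0 * d|.
  by rewrite normrM ler_wpM2r//; apply: (le_trans convex); exact: ler_norm.
have := ler_normB (t (k + 1) - t k) (t (k + 1) - t k - b 1%N k 0 * d).
rewrite subKr; lra.
Qed.

End homogenized.

(** * Consistency of the corrected solution *)

Section comparison.
Context {R : realType}.
Variables (N p m : nat) (Phi : potential R) (chis : int -> R) (rhoPhi : R).
Variables (chi : R -> int -> R) (c0 rho r0 : R).
Hypotheses (p0 : (0 < p)%N) (N0 : (0 < N)%N) (pN : (p %| N)%N).
Hypothesis Phi_per : forall (r : nat) (y : int), (1 <= r <= m)%N ->
  Phi r (y + p%:Z) = Phi r y.
Hypothesis chisU : Usharp p chis.
Hypothesis rhoPhi0 : 0 < rhoPhi.
Hypothesis smooth : assumption1 m Phi chis rhoPhi.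
Let h : R := eps N.
Let a (r : nat) (k : int) := derive1 (Phi r k).
Let b (r : nat) (k : int) := derive1n 2 (Phi r k).
Let C2 := C2Phi p m Phi chis rhoPhi.
Hypothesis c00 : 0 < c0.
Hypothesis stab : stable N h m (fun r k => b r k (Diff 1 r chis k)) (2 * c0).
Hypothesis rho_le : 0 < rho <= rhoPhi.
Hypothesis small : 3 * m%:R * C2 * rho <= c0.
Hypothesis r0_gt0 : 0 < r0.
Hypothesis r0_le : r0 <= rho / 2.
Hypothesis branch : forall z, `|z| < r0 ->
    [/\ Usharp p (chi z), snorm_inf p 1 1 (chi z - chis) < rho / 2 &
        forall v, Usharp p v -> core p 1 m (fun r k => a r k (strain 1 z (chi z) r k)) v = 0].
Hypothesis chi0 : chi 0 = chis.
Variable Lam : R.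
Hypothesis Lam0 : 0 <= Lam.
Hypothesis chi_lip : forall z z' k, `|z| < r0 -> `|z'| < r0 ->
  2 * `|chi z k - chi z' k| <= Lam * `|z - z'|.

Let h0 : 0 < h. Proof. exact: eps_gt0. Qed.
Let hchisU : Usharp N (h *: chis).
Proof. exact/UsharpZ/(Usharp_dvdn p0 N0 pN). Qed.

Section fixed_u0.
Variable u0 : int -> R.
Hypothesis u0U : Usharp N u0.
Hypothesis u0r : snorm_inf N h 1 u0 < r0.
Let e := Diff h 1 u0.
Let w k := u0 k + h * chi (e k) k.
Let uc := corrected N chi u0.

Let he : periodic e N%:Z. Proof. by apply: Diff_periodic; case: u0U. Qed.
Let eE k : `|e k| <= snorm_inf N h 1 u0. Proof. exact: le_norm_inf. Qed.
Let er k : `|e k| < r0. Proof. exact: le_lt_trans (eE k) u0r. Qed.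
Let chi_per z : `|z| < r0 -> periodic (chi z) N%:Z.
Proof. by move=> /branch[[hz _] _ _]; exact: periodic_dvdn hz. Qed.

Let hw : periodic w N%:Z.
Proof. by move=> k; rewrite /w he (proj1 u0U) chi_per. Qed.

Let ucU : Usharp N uc. Proof. exact: Usharp_Isharp. Qed.

Let Diff_uc r j : Diff h r uc j =
  Diff h r u0 j + (chi (e (j + r%:Z)) (j + r%:Z) - chi (e j) j) / r%:R.
Proof.
rewrite (_ : uc = Isharp N w)// Diff_Isharp /w DiffE (DiffE h r u0).
have e1 : h * h^-1 = 1 by rewrite mulfV// gt_eqF.
by rewrite -[X in _ = _ + X]mulr1 -[X in _ = _ + _ * X]e1 !invfM; ring.
Qed.

(** The gradient of uc - eps chis is Du0 plus a difference of two values of chi(Du0) - chi(0). The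
    factor 2 in [chi_lip] lets these two add up to Lam |u0|_{1,oo}. *)
Lemma corrected_ball rhou : (1 + Lam) * snorm_inf N h 1 u0 < rhou ->
  ball_star N chis rhou uc.
Proof.
move=> Lr; split=> //; apply: le_lt_trans Lr; set E := snorm_inf N h 1 u0.
have eE' k : `|e k| <= E by exact: eE.
have E0 : 0 <= E by exact: snorm_inf_ge0.
apply: norm_inf_le => [|k]; first by rewrite mulr_ge0// addr_ge0.
rewrite [iter _ _ _]DiffB Diff_eps// !fctE Diff_uc divr1 (Diff1E 1) divr1 -/e.
have z0 : `|0 : R| < r0 by rewrite normr0.
have l1 := chi_lip (k + 1) (er (k + 1)) z0; have l2 := chi_lip k (er k) z0.
rewrite !subr0 chi0 in l1 l2.
have -> : e k + (chi (e (k + 1)) (k + 1) - chi (e k) k) - (chis (k + 1) - chis k)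
  = e k + ((chi (e (k + 1)) (k + 1) - chis (k + 1)) - (chi (e k) k - chis k)) by ring.
apply: (le_trans (ler_normD _ _)); rewrite mulrDl mul1r lerD//.
apply: (le_trans (ler_normB _ _)).
have m1 : Lam * `|e (k + 1)| <= Lam * E by rewrite ler_wpM2l.
have m2 : Lam * `|e k| <= Lam * E by rewrite ler_wpM2l.
lra.
Qed.

Let X2 := snorm_inf N h 2 u0.

Let e_step j : `|e (j + 1) - e j| <= h * X2.
Proof.
have := le_norm_inf j N0 (Diff_periodic h 1 he); rewrite Diff1E normrM normfV.
by rewrite (gtr0_norm h0) ler_pdivrMr// mulrC.
Qed.

(* Freezing the macroscopic strain at [e k] changes the microscopic strain
   [i < r <= m] sites away by [O(h X2)] only. *)
Let frozen_strain r (i : nat) k : (1 <= r <= m)%N -> (i < r)%N ->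
  `|Diff h r uc (k - i%:Z) - strain 1 (e k) (chi (e k)) r (k - i%:Z)|
    <= (2 * m%:R + 2 * m%:R * Lam) * (h * X2).
Proof.
move=> /andP[r1 rm] ir; set j := k - i%:Z; set d := h * X2.
have d0 : 0 <= d by rewrite mulr_ge0 ?snorm_inf_ge0// ltW.
(* Site j + l is i steps back and l steps forward from k, both at most m. *)
have far (l : nat) : (l <= r)%N -> `|e (j + l%:Z) - e k| <= 2 * m%:R * d.
  move=> lr; apply: (le_trans (shift_le k i l e_step)).
  rewrite ler_wpM2r// mulrDl mul1r lerD// ler_nat; lia.
have near (l : nat) : (l <= r)%N ->
    `|chi (e (j + l%:Z)) (j + l%:Z) - chi (e k) (j + l%:Z)| <= m%:R * Lam * d.
  move=> lr; have l1 := chi_lip (j + l%:Z) (er (j + l%:Z)) (er k).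
  have : Lam * `|e (j + l%:Z) - e k| <= Lam * (2 * m%:R * d) by rewrite ler_wpM2l ?far.
  by rewrite (_ : Lam * (2 * _ * d) = 2 * (m%:R * Lam * d)); [lra|ring].
rewrite Diff_uc /strain (DiffE 1) mulr1.
have -> : Diff h r u0 j + (chi (e (j + r%:Z)) (j + r%:Z) - chi (e j) j) / r%:R
  - (e k + (chi (e k) (j + r%:Z) - chi (e k) j) / r%:R) =
  (Diff h r u0 j - e k) + ((chi (e (j + r%:Z)) (j + r%:Z) - chi (e k) (j + r%:Z))
   - (chi (e j) j - chi (e k) j)) / r%:R by ring.
apply: (le_trans (ler_normD _ _)); rewrite [leRHS]mulrDl lerD//.
  have rn : r%:R != 0 :> R by rewrite pnatr_eq0 -lt0n.
  rewrite Diff_avg// (_ : _ - e k = r%:R^-1 * \sum_(0 <= l < r) (e (j + l%:Z) - e k)).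
    rewrite normrM ger0_norm ?invr_ge0 ?ler0n// ler_pdivrMl ?ltr0n//.
    apply: (le_trans (ler_norm_sum _ _ _)).
    rewrite [leRHS](_ : _ = \sum_(0 <= l < r) (2 * m%:R * d)); last first.
      by rewrite big_const_nat subn0 iter_addr_0 -[RHS]mulr_natl.
    by rewrite big_nat [leRHS]big_nat; apply: ler_sum => l /andP[_ lr]; apply/far/ltnW.
  rewrite sumrB mulrBr; congr (_ - _).
  by rewrite big_const_nat subn0 iter_addr_0 -[X in _ * X]mulr_natl mulKf.
rewrite normrM normfV (ger0_norm (ler0n _ r)) ler_pdivrMr ?ltr0n//.
have n1 := near r (leqnn r); have n2 := near 0%N (leq0n r); rewrite addr0 in n2.
apply: (le_trans (ler_normB _ _)).
apply: (@le_trans _ _ (2 * m%:R * Lam * d)).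
  by rewrite (_ : 2 * m%:R * Lam * d = m%:R * Lam * d + m%:R * Lam * d); [lra|ring].
by rewrite ler_peMr ?ler1n// mulr_ge0// mulr_ge0// mulr_ge0.
Qed.

Let strain_ball z r k : `|z| < r0 -> (1 <= r <= m)%N ->
  `|strain 1 z (chi z) r k - Diff 1 r chis k| < rhoPhi.
Proof.
move=> hz /andP[r1 _]; have [hu Xu _] := branch hz; case/andP: rho_le => _.
apply: lt_le_trans; rewrite /strain -addrA; apply: (le_lt_trans (ler_normD _ _)).
rewrite [X in _ + `|X|](_ : _ = Diff 1 r (chi z - chis) k); last by rewrite DiffB.
rewrite [ltRHS]splitr ltr_leD// ?(lt_le_trans hz)//.
apply: (le_trans _ (ltW Xu)); apply: Diff_le => //.
by case: (UsharpB hu chisU).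
Qed.

Variable La : R.
Hypothesis La0 : 0 <= La.
Hypothesis a_lip : forall (r : nat) k x y, (1 <= r <= m)%N ->
  `|x - Diff 1 r chis k| < rhoPhi -> `|y - Diff 1 r chis k| < rhoPhi ->
  `|a r k x - a r k y| <= La * `|x - y|.
Hypothesis dPhi0 : forall z, `|z| < r0 -> derive1 (Phi0 p m Phi chi) z =
  \sum_(1 <= r < m.+1) mean p (fun k => a r k (z + Diff 1 r (chi z) k)).

(** Both problems carry the same load f, so stability leaves a difference of two stress fields
    tested with Dv, which only has to be bounded pointwise. *)
Lemma corrected_error f u : ball_star N chis rho u -> ball_star N chis rho uc ->
  equilibrium N m a f u ->
  equilibrium N 1 (fun _ _ => derive1 (Phi0 p m Phi chi)) f u0 ->
  c0 * snorm_inf N h 1 (uc - u) <=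
    m%:R * (La * ((2 * m%:R + 2 * m%:R * Lam) * (h * X2))).
Proof.
move=> [uU ur] [_ ucr] equ equ0; set M := m%:R * _.
have X20 : 0 <= X2 by exact: snorm_inf_ge0.
have M0 : 0 <= M.
  rewrite mulr_ge0// mulr_ge0// mulr_ge0 ?(mulr_ge0 (ltW h0))//.
  by rewrite addr_ge0 ?mulr_ge0.
have ball v : Usharp N v -> snorm_inf N h 1 (v - h *: chis) < rho ->
    inball m (fun r => Diff 1 r chis) rho (fun r => Diff h r v).
  move=> vU vr r k /andP[r1 _]; apply: le_lt_trans vr; rewrite -(Diff_eps r chis N0).
  rewrite [X in `|X|](_ : _ = Diff h r (v - h *: chis) k); last by rewrite DiffB.
  by apply: Diff_le => //; case: (UsharpB vU hchisU).
have reg := regular_weak rho_le (potential_regular p0 Phi_per chisU rhoPhi0 smooth).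
apply: (nonlinear_stability N0 reg stab small (ball _ ucU ucr) (ball _ uU ur) (UsharpB ucU uU)).
  by move=> r k _; rewrite DiffB.
split=> // v hv; rewrite coreB (equ v hv) -(equ0 v hv) core1E.
pose s r k := a r k (Diff h r uc k).
have hs (r : nat) : (1 <= r <= m)%N -> periodic (s r) N%:Z.
  move=> hr k; rewrite /s (Diff_periodic h r (proj1 ucU)) /a.
  by rewrite (@periodic_dvdn _ p N (Phi r) pN)// => y; exact: Phi_per.
rewrite (core_avg_stress _ hs (proj1 hv)) -dotpBl; apply: dotp_Diff_le => k.
have [_ _ cell] := branch (er k).
have hc (r : nat) : (1 <= r <= m)%N ->
    periodic (fun j => a r j (strain 1 (e k) (chi (e k)) r j)) p%:Z.
  move=> hr j; rewrite /a Phi_per// /strain Diff_periodic//.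
  by case: (branch (er k)) => -[].
(* At each k the derivative of Phi^0 at e k is replaced by the averaged stress at the same k of the
   cell problem with strain e k, so that the two averages are compared bond by bond. *)
rewrite !fctE -/e (dPhi0 (er k)) -(avg_stress_cell p0 ltr01 hc cell k) -avg_stressB.
apply: avg_stress_le => r i hr ir.
have hs1 : `|Diff h r uc (k - i%:Z) - Diff 1 r chis (k - i%:Z)| < rhoPhi.
  by apply: (lt_le_trans (ball _ ucU ucr r _ hr)); case/andP: rho_le.
apply: (le_trans (a_lip hr hs1 (strain_ball _ (er k) hr))).
by rewrite ler_wpM2l// frozen_strain.
Qed.

End fixed_u0.
End comparison.

(** * Choice of constants and radii, and the three claims combined *)

Theorem theorem3p4 (R : realType) (A : R) (p : nat) (hp : (0 < p)%N) :
  exists Kp : R,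
  forall (rmax : nat) (hrmax : (0 < rmax)%N),
  exists (Ka Kb : R -> R -> R) (Kc Kd : R -> R),
  forall (Phi : potential R) (chis : int -> R) (rhoPhi : R),
    (forall (r : nat) (y : int), (1 <= r <= rmax)%N ->
       Phi r (y + p%:Z) = Phi r y) ->
    Usharp p chis -> 0 < rhoPhi ->
    assumption0 chis ->
    assumption1 rmax Phi chis rhoPhi ->
    assumption2 p rmax Phi chis ->
    assumption3 p rmax Phi chis ->
  forall (rhoz rhochi : R) (chi : R -> int -> R),
    0 < rhoz -> 0 < rhochi -> rhochi <= A -> rhoz + rhochi <= rhoPhi ->
    is_corrector p rmax Phi chis rhoz rhochi chi ->
  forall c0 : R, 0 < c0 -> cell_coercive p rmax Phi chis chi c0 ->
  exists rhof rhou : R,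
    [/\ 0 < rhof, 0 < rhou, rhou <= rhoPhi, rhou <= rhoz &
    forall N : nat, (0 < N)%N -> (p %| N)%N ->
      lattice_coercive N p rmax Phi chis chi c0 ->
    let Bf := ball_f N rhof in
    let Bstar := ball_star N chis rhou in
    let B0 := ball_zero N rhou in
    let C2 := C2Phi p rmax Phi chis rhoPhi in
    let C11 := C11Phi p rmax Phi chis rhoPhi in
    exists u u0 : (int -> R) -> (int -> R),
    [/\ (* (a) *)
        unique_solution_map Bf Bstar (atomistic_solution N rmax Phi) u /\
        (exists du, [/\ is_C11 N Bf u du,
           (deriv_normC N Bf du <= (c0^-1)%:E)%E &
           (deriv_lip N Bf du <= (Ka c0 C2)%:E)%E]),
        (* (b) *)
        [/\ unique_solution_map Bf B0
              (homogenized_solution N p rmax Phi chi) u0,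
            (exists du0, [/\ is_C11 N Bf u0 du0,
               (deriv_normC N Bf du0 <= (c0^-1)%:E)%E &
               (deriv_lip N Bf du0 <= (Kb c0 C2)%:E)%E]),
            (forall f, Bf f ->
               snorm_inf N (eps N) 2 (u0 f) <= c0^-1 * norm_inf N f) &
            (forall f, Bf f -> Bstar (corrected N chi (u0 f)))] &
        (* (c) *)
        forall f, Bf f ->
        [/\ 2 * norm_inf N (corrected N chi (u0 f) - u f)
              <= snorm_inf N (eps N) 1 (corrected N chi (u0 f) - u f),
            snorm_inf N (eps N) 1 (corrected N chi (u0 f) - u f)
              <= eps N * Kc (c0^-1 * C11) * snorm_inf N (eps N) 2 (u0 f) &
            norm_inf N (u0 f - u f)
              <= eps N * Kd (c0^-1 * C11) * snorm_inf N (eps N) 2 (u0 f)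
                 + eps N * Kp]]].
Proof.
(* |chi(z)|_{1,oo} <= |chis|_{1,oo} + rhochi <= p + A, and a mean-zero function on the cell
   satisfies 2 |chi| <= p |chi|_{1,oo}. *)
exists (p%:R * (p%:R + A)) => m m0.
pose Kc (t : R) := m%:R * t * (2 * m%:R + 2 * m%:R * (p%:R * (m%:R * t))).
exists (fun c C => m%:R * C / c ^+ 3),
  (fun c C => 1%:R * (m%:R * C * (1 + m%:R * C / c) ^+ 3) / c ^+ 3), Kc, Kc.
move=> Phi chis rhoPhi per chisU rhoPhi0 incr smooth eqs _ rhoz rhochi chi rz rc rcA _ corr.
move=> c0 c00 [/(infsup_stable hp (fun w v => erefl)) stab convex].
set C2 := C2Phi p m Phi chis rhoPhi; set C11 := C11Phi p m Phi chis rhoPhi.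
have C20 : 0 <= C2 by exact: C2Phi_ge0.
have C110 : 0 <= C11 by exact: C11Phi_ge0.
(* Largest allowed radius, reduced so that K times it is at most c; K + 1 admits K = 0. *)
pose small_radius (rho K c : R) := Num.min rho (c / (K + 1)).
have srP (rho K : R) : 0 < rho -> 0 <= K ->
    [/\ 0 < small_radius rho K c0, small_radius rho K c0 <= rho &
        K * small_radius rho K c0 <= c0].
  move=> r0 K0; have K1 : 0 < K + 1 by rewrite ltr_wpDl.
  have s0 : 0 < small_radius rho K c0 by rewrite lt_min r0 divr_gt0.
  split=> //; first by rewrite ge_min lexx.
  apply: (@le_trans _ _ ((K + 1) * small_radius rho K c0)).
    by rewrite ler_wpM2r ?lerDl// ltW.
  by rewrite mulrC -ler_pdivlMr// ge_min lexx orbT.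
have [rho0 rho_le small] := srP rhoPhi (3 * m%:R * C2) rhoPhi0 (mulr_ge0 (mulr_ge0 (ler0n _ 3) (ler0n _ m)) C20).
set rho := small_radius _ _ _ in rho0 rho_le small.
have rhoP : 0 < rho <= rhoPhi by rewrite rho0.
have [r0 [r00 r0z r0rho branch]] :=
  corrector_branch hp per chisU rhoPhi0 smooth c00 stab rhoP small eqs rz rc corr.
(* At z = 0 Assumption 2 is the cell equation for [chis], so uniqueness applies. *)
have chi0 : chi 0 = chis.
  have z0 : `|0 : R| < rhoz by rewrite normr0.
  have [_ H] := corr 0 z0; apply/esym/H; split=> //; first by rewrite subrr snorm_inf0.
  move=> v hv; apply: etrans (eqs v hv); apply: eq_core => r k _.
  by rewrite add0r.
have [dchi dchiP] := corrector_derivative_ex hp per chisU rhoPhi0 smooth c00 stab rhoP small r0rho branch.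
have dPhi0 := derive1_Phi0 hp per chisU rhoPhi0 smooth c00 stab rhoP small r0rho branch dchiP.
have reg0 := Phi0_regular hp per chisU rhoPhi0 smooth c00 stab rhoP small r00 r0rho branch dchiP.
set L0 := _ * _ ^+ 3 in reg0; have L00 : 0 <= L0 by case: reg0.
have chi_lip K : 0 <= K -> (forall (r : nat) k x y, (1 <= r <= m)%N ->
     `|x - Diff 1 r chis k| < rhoPhi -> `|y - Diff 1 r chis k| < rhoPhi ->
     `|derive1 (Phi r k) x - derive1 (Phi r k) y| <= K * `|x - y|) ->
   forall z z' k, `|z| < r0 -> `|z'| < r0 ->
     2 * `|chi z k - chi z' k| <= p%:R * (m%:R * K / c0) * `|z - z'|.
  move=> K0 HK z z' k hz hz'.
  have := corrector_lipschitz hp per chisU rhoPhi0 smooth stab rhoP small r0rho branch K0 HK hz hz'.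
  rewrite mulrC -ler_pdivlMr// => XK.
  have [hu _ _] := branch z hz; have [hu' _ _] := branch z' hz'.
  apply: (le_trans (Usharp_sup_le k hp ltr01 (UsharpB hu hu'))).
  rewrite mulr1 -mulrA ler_wpM2l//; apply: (le_trans XK).
  by rewrite mulrAC.
(* The first constant fixes [rhof]; the second goes into the error estimate, whose constant may
   involve C11 / c0 only. *)
have chi_lip2 := chi_lip C2 C20 (stress_lipschitz_C2 hp per chisU rhoPhi0 smooth).
have chi_lip11 := chi_lip C11 C110 (stress_lipschitz_C11 hp per chisU rhoPhi0 smooth).
set Lam2 := p%:R * _ in chi_lip2; set Lam := p%:R * _ in chi_lip11.
have Lam20 : 0 <= Lam2 by rewrite !mulr_ge0 ?invr_ge0// ltW.
have Lam0 : 0 <= Lam by rewrite !mulr_ge0 ?invr_ge0// ltW.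
have [rhou0 rhou_le smallu] := srP r0 (3 * 1%:R * L0) r00 (mulr_ge0 (mulr_ge0 (ler0n _ 3) (ler0n _ 1)) L00).
set rhou := small_radius _ _ _ in rhou0 rhou_le smallu.
have rhou_rho : rhou <= rho by lra.
have L1 : 0 < 1 + Lam2 by rewrite ltr_pwDl.
(* Since c0 |u0|_{1,oo} <= |f|_{-1,oo}, this gives (1 + Lam2) |u0|_{1,oo} < rhou, the condition
   under which the corrected solution stays in [ball_star]. *)
pose rhof := c0 * rhou / (1 + Lam2).
have rhofP : rhof <= c0 * rhou.
  by rewrite ler_pdivrMr// ler_peMr ?lerDl// mulr_ge0// ltW.
exists rhof, rhou; split=> //; [by rewrite divr_gt0// mulr_gt0|lra|lra|].
move=> N N0 pN [latN hom] /=; have h0 : 0 < eps N :> R by exact: eps_gt0.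
have hus : Usharp N (eps N *: chis) by exact/UsharpZ/(Usharp_dvdn hp N0 pN).
have E r : Diff (eps N) r (eps N *: chis) = Diff 1 r chis by exact: Diff_eps.
have EE : (fun r => Diff (eps N) r (eps N *: chis)) = fun r => Diff 1 r chis.
  by apply/funext.
have E0 : (fun r => Diff (eps N) r (0 : int -> R)) = fun _ _ => 0.
  by apply/funext => r; exact: Diff0.
pose a (r : nat) k := derive1 (Phi r k); pose b (r : nat) k := derive1n 2 (Phi r k).
pose a0 (_ : nat) (_ : int) := derive1 (Phi0 p m Phi chi).
pose b0 (_ : nat) (_ : int) := derive1n 2 (Phi0 p m Phi chi).
have stabN := infsup_stable N0 (fun w v => erefl) latN.
have stabN1 : stable N (eps N) m (fun r k => b r k (Diff 1 r chis k)) (2 * c0).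
  have e : (fun r k => b r k (Diff 1 r chis k)) =
           (fun r k => b r k (Diff (eps N) r (eps N *: chis) k)).
    by apply/funext => r; rewrite E.
  by rewrite e; exact: stabN.
have regN : regular m a b (fun r => Diff (eps N) r (eps N *: chis)) rhou C2.
  rewrite EE; apply: (@regular_weak _ m a b _ rhoPhi); first by rewrite rhou0; lra.
  exact: potential_regular.
have smallN : 3 * m%:R * C2 * rhou <= c0.
  by apply: le_trans small; rewrite ler_wpM2l// !mulr_ge0.
have eqN v : Usharp N v -> core N (eps N) m (fun r k => a r k (Diff (eps N) r (eps N *: chis) k)) v = 0.
  exact: (equilibrium_chis hp N0 pN per chisU eqs).
have reg0N : regular 1 a0 b0 (fun r => Diff (eps N) r 0) rhou L0.
  by rewrite E0; apply: regular_weak reg0; rewrite rhou0.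
have stab0N : stable N (eps N) 1 (fun r k => b0 r k (Diff (eps N) r (0 : int -> R) k)) (2 * c0).
  apply: (infsup_stable N0 _ hom) => w v; rewrite /core big_nat1 /homogenized_hessian.
  by apply: mean_eq => k; rewrite Diff0.
have eq0N v : Usharp N v -> core N (eps N) 1 (fun r k => a0 r k (Diff (eps N) r 0 k)) v = 0.
  move=> [hv _]; rewrite core1E; apply: (@dotp_cst_Diff _ N _ _ (a0 0%N 0 0)) => // k.
  by rewrite Diff0.
have [u [solu du]] := solution_map N0 c00 regN stabN smallN hus eqN rhofP.
have [u0 [solu0 du0]] := solution_map N0 c00 reg0N stab0N smallu (Usharp0 N) eq0N rhofP.
have u0X f : ball_f N rhof f -> [/\ Usharp N (u0 f),
    snorm_inf N (eps N) 1 (u0 f) < rhou & (1 + Lam2) * snorm_inf N (eps N) 1 (u0 f) < rhou].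
  move=> hf; have [[hu ur] su _] := solu0 f hf.
  have := equilibrium_center N0 reg0N stab0N smallu (Usharp0 N) eq0N (conj hu ur) su.
  rewrite subr0 in ur *; split=> //.
  have := proj2 hf; rewrite /rhof ltr_pdivlMr// => h2.
  rewrite -(ltr_pM2l c00); apply: le_lt_trans h2.
  by rewrite mulrCA mulrC ler_wpM2r// ltW.
have homE f w : homogenized_solution N p m Phi chi f w <-> equilibrium N 1 a0 f w.
  by split=> H v hv; have := H v hv; rewrite core1E.
have ucB f : ball_f N rhof f -> ball_star N chis rhou (corrected N chi (u0 f)).
  move=> hf; have [hu ur ur2] := u0X f hf.
  exact: (corrected_ball N0 pN r00 branch chi0 Lam20 chi_lip2 hu (lt_le_trans ur rhou_le) ur2).
exists u, u0; split.
- split; last exact: du.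
  move=> f hf; have [[hu ur] su uniq] := solu f hf.
  have atE w : ball_star N chis rhou w ->
      atomistic_solution N m Phi f w <-> equilibrium N m a f w.
    move=> [hw wr]; apply: (atomistic_solutionE N0 pN chisU smooth) => //.
      by apply: (lt_le_trans wr); lra.
    by case: hw.
  split=> //; first by apply/atE.
  by move=> w wB /(atE w wB); exact: uniq.
- split=> //.
  + move=> f hf; have [hu ur _] := u0X f hf; have [_ su uniq] := solu0 f hf.
    split=> //; first exact/homE.
    move=> w [hw wr] /homE sw; apply: uniq => //; split=> //.
    by rewrite subr0.
  + move=> f hf; have [hu ur _] := u0X f hf; have [_ su _] := solu0 f hf.
    have regu : regular 1 a0 b0 (fun _ _ => 0) rhou L0.
      by apply: regular_weak reg0; rewrite rhou0.
    exact: (@second_difference_bound R N (Phi0 p m Phi chi) rhou L0 c0 N0 c00 regu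
      smallu convex f (u0 f) (proj1 hf) hu ur su).
move=> f hf; have [hu0 u0r _] := u0X f hf; have [uB su _] := solu f hf.
have ucf := ucB f hf; set uc := corrected N chi (u0 f) in ucf *.
have dU : Usharp N (uc - u f) by apply: UsharpB; [case: ucf|case: uB].
have half := two_norm_inf_le N0 dU.
have C11E : m%:R * C11 / c0 = m%:R * (c0^-1 * C11) by ring.
have main : snorm_inf N (eps N) 1 (uc - u f) <=
    eps N * Kc (c0^-1 * C11) * snorm_inf N (eps N) 2 (u0 f).
  have wB w : ball_star N chis rhou w -> ball_star N chis rho w.
    by move=> [hw wr]; split=> //; apply: lt_le_trans rhou_rho.
  have [_ su0 _] := solu0 f hf.
  have := @corrected_error R N p m Phi chis rhoPhi chi c0 rho r0 hp N0 pN per chisU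
    rhoPhi0 smooth c00 stabN1 rhoP small r00 r0rho branch Lam Lam0 chi_lip11 (u0 f) hu0
    (lt_le_trans u0r rhou_le) C11 C110 (stress_lipschitz_C11 hp per chisU rhoPhi0 smooth) dPhi0
    f (u f) (wB _ uB) (wB _ ucf) su su0.
  rewrite mulrC -ler_pdivlMr// => /le_trans; apply.
  rewrite /Lam C11E /Kc; set X2 := snorm_inf _ _ 2 _.
  by rewrite le_eqVlt; apply/orP; left; apply/eqP; ring.
split=> //; apply: norm_inf_le => [|k].
  rewrite addr_ge0//; first by apply: le_trans main; exact: snorm_inf_ge0.
  by rewrite mulr_ge0 ?(ltW h0)// mulr_ge0// addr_ge0//; lra.
rewrite [X in `|X|](_ : _ = (uc - u f) k + (u0 f - uc) k); last by rewrite !fctE; ring.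
apply: (le_trans (ler_normD _ _)); apply: lerD.
  apply: le_trans main; apply: (le_trans (le_norm_inf k N0 (proj1 dU))).
  by have := norm_inf_ge0 N (uc - u f); lra.
pose e := Diff (eps N) 1 (u0 f).
have er j : `|e j| < r0.
  by apply: lt_le_trans rhou_le; apply: le_lt_trans u0r; apply: le_norm_inf => //;
    apply: Diff_periodic; case: hu0.
have chi_le j i : 2 * `|chi (e j) i| <= p%:R * (p%:R + A).
  have [hc _ _] := branch _ (er j).
  have [[_ Xc _] _] := corr (e j) (lt_le_trans (er j) r0z).
  have h1 := Usharp_sup_le i hp ltr01 hc; rewrite mulr1 in h1.
  apply: (le_trans h1); rewrite ler_wpM2l//.
  rewrite -[chi (e j)](subrK chis) addrC.
  apply: (le_trans (snorm_infD _ hp (proj1 chisU) (proj1 (UsharpB hc chisU)))).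
  apply: lerD; first exact: assumption0_snorm hp (proj1 chisU) incr.
  by apply: ltW; apply: lt_le_trans rcA.
(* u0 has zero mean, so [Isharp] leaves only the corrector and its mean; each contributes at most
   half of Kp. *)
have -> : (u0 f - uc) k = eps N * (mean N (fun j => chi (e j) j) - chi (e k) k).
  rewrite !fctE /uc /corrected /Isharp meanD (proj2 hu0) meanZ.
  by rewrite -/e; ring.
rewrite normrM (gtr0_norm h0) ler_wpM2l ?(ltW h0)//.
apply: (le_trans (ler_normB _ _)).
have m1 : `|mean N (fun j => chi (e j) j)| <= p%:R * (p%:R + A) / 2.
  apply: (le_trans (mean_norm _ _)); rewrite -[leRHS](mean_cst _ N0).
  by apply: mean_le => j; rewrite ler_pdivlMr// mulrC.
have := chi_le k k; lra.
Qed.
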